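(* If an automorphism $R$ is weakly mixing and has the convolution singularity (CS) property, then it has the joining primeness (JP) property.
   Context: All systems are automorphisms (invertible measure-preserving transformations) of standard Borel probability spaces. CS: an automorphism $R$ has the CS property if its reduced maximal spectral type (the maximal spectral type of the Koopman operator on the orthocomplement $L^2_0$ of the constants) is singular with respect to $\lambda_1*\lambda_2$ for any two continuous (i.e. atomless) finite positive Borel measures $\lambda_1,\lambda_2$ on the circle. A joining of automorphisms $T$ of $(X,\mathcal{B},\mu)$ and $S$ of $(Y,\mathcal{C},\nu)$ is a $T\times S$-invariant probability measure on $X\times Y$ with marginals $\mu,\nu$; $J^e(T,S)$ is the set of ergodic joinings. JP: an ergodic automorphism $R$ of $(Z,\mathcal{D},\rho)$ has the JP property if for every pair of weakly mixing automorphisms $S_i$ of $(Y_i,\mathcal{C}_i,\nu_i)$, $i=1,2$, and every $\lambda\in J^e(R,S_1\times S_2)$, one has $\lambda=\lambda_{Z,Y_1}\otimes\nu_2$ or $\lambda=\lambda_{Z,Y_2}\otimes\nu_1$, where $\lambda_{Z,Y_i}$ is the projection of $\lambda$ on $Z\times Y_i$. *)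

(* Defs.v *)
From HB Require Import structures.
From mathcomp Require Import all_boot all_order all_algebra.
From mathcomp Require Import complex.
From mathcomp Require Import all_classical all_reals all_analysis.
From mathcomp Require Import measurable_realfun.

Set Implicit Arguments.
Unset Strict Implicit.
Unset Printing Implicit Defensive.

Import Order.TTheory GRing.Theory Num.Theory.
Import numFieldNormedType.Exports.

Local Open Scope classical_set_scope.
Local Open Scope ring_scope.
Local Open Scope complex_scope.

(* Borel isomorphism with a Polish space: a Hausdorff pseudometric space is
   metric, and completeness is part of the structure. *)
Definition standard_borel (R : realType) d (X : measurableType d) : Prop :=
  exists (P : completePseudoMetricType R) (f : X -> P),
    [/\ hausdorff_space P,
        exists2 D : set P, countable D & dense D,
        bijective f &
        forall A : set P, <<s @open P >> A <-> measurable (f @^-1` A)].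

Record automorphism (R : realType) d (X : measurableType d)
    (mu : probability X R) := Automorphism {
  aut_fun :> X -> X;
  aut_inv : X -> X;
  aut_funK : cancel aut_fun aut_inv;
  aut_invK : cancel aut_inv aut_fun;
  measurable_aut_fun : measurable_fun setT aut_fun;
  measurable_aut_inv : measurable_fun setT aut_inv;
  aut_preserving : forall A, measurable A -> mu (aut_fun @^-1` A) = mu A }.

Definition aut_iter (R : realType) d (X : measurableType d)
    (mu : probability X R) (T : automorphism mu) (n : int) : X -> X :=
  match n with
  | Posz k => iter k T
  | Negz k => iter k.+1 (aut_inv T)
  end.

Definition ergodic (R : realType) d (X : measurableType d)
    (mu : set X -> \bar R) (T : X -> X) : Prop :=
  forall A, measurable A -> T @^-1` A = A -> mu A = 0%E \/ mu A = 1%E.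

Definition weakly_mixing (R : realType) d (X : measurableType d)
    (mu : probability X R) (T : automorphism mu) : Prop :=
  forall A B, measurable A -> measurable B ->
    (fun N : nat => N%:R^-1 * \sum_(k < N)
       `|fine (mu ((iter k T @^-1` A) `&` B)) - fine (mu A) * fine (mu B)|)
      @ \oo --> (0 : R).

Section product_automorphism.
Context (R : realType) d1 d2 (X : measurableType d1) (Y : measurableType d2).

Definition prod_map (T : X -> X) (S : Y -> Y) (p : X * Y) : X * Y :=
  (T p.1, S p.2).

Lemma measurable_prod_map (T : X -> X) (S : Y -> Y) :
  measurable_fun setT T -> measurable_fun setT S ->
  measurable_fun setT (prod_map T S).
Proof.
move=> mT mS; apply/measurable_fun_pairP; split.
  exact: (measurableT_comp mT measurable_fst).
exact: (measurableT_comp mS measurable_snd).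
Qed.

Context (mu : probability X R) (nu : probability Y R).
Context (T : automorphism mu) (S : automorphism nu).

Lemma prod_map_preserving A : measurable A ->
  (mu \x nu)%E (prod_map T S @^-1` A) = (mu \x nu)%E A.
Proof.
move=> mA.
have mTS := measurable_prod_map (measurable_aut_fun T) (measurable_aut_fun S).
pose f : {mfun (X * Y)%type >-> (X * Y)%type} :=
  HB.pack (prod_map T S) (isMeasurableFun.Build _ _ _ _ (prod_map T S) mTS).
have -> : (mu \x nu)%E (prod_map T S @^-1` A) =
          distribution (mu \x nu)%E f A by [].
symmetry; apply: product_measure_unique => // B C mB mC.
change ((mu \x nu)%E ((T @^-1` B) `*` (S @^-1` C)) = (mu B * nu C)%E).
have mT : measurable (T @^-1` B).
  by rewrite -[X in measurable X]setTI; exact: (measurable_aut_fun T).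
have mS : measurable (S @^-1` C).
  by rewrite -[X in measurable X]setTI; exact: (measurable_aut_fun S).
rewrite product_measure1E//; congr (_ * _)%E; exact: aut_preserving.
Qed.

Definition prod_aut : automorphism (mu \x nu)%E :=
  @Automorphism R _ _ (mu \x nu)%E (prod_map T S)
    (prod_map (aut_inv T) (aut_inv S))
    (fun p => let: (x, y) := p in
       congr2 pair (aut_funK T x) (aut_funK S y))
    (fun p => let: (x, y) := p in
       congr2 pair (aut_invK T x) (aut_invK S y))
    (measurable_prod_map (measurable_aut_fun T) (measurable_aut_fun S))
    (measurable_prod_map (measurable_aut_inv T) (measurable_aut_inv S))
    prod_map_preserving.

Definition joining (lambda : probability (X * Y)%type R) : Prop :=
  [/\ forall A, measurable A -> lambda (prod_map T S @^-1` A) = lambda A,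
      forall A, measurable A -> lambda (fst @^-1` A) = mu A &
      forall B, measurable B -> lambda (snd @^-1` B) = nu B].

Definition ergodic_joining (lambda : probability (X * Y)%type R) : Prop :=
  joining lambda /\ ergodic lambda (prod_map T S).

End product_automorphism.

Section joining_primeness.
Context (R : realType) d d1 d2 (Z : measurableType d)
  (Y1 : measurableType d1) (Y2 : measurableType d2).

Definition proj_Z1 (p : Z * (Y1 * Y2)) : Z * Y1 := (p.1, p.2.1).
Definition proj_Z2 (p : Z * (Y1 * Y2)) : Z * Y2 := (p.1, p.2.2).

Lemma measurable_proj_Z1 : measurable_fun setT proj_Z1.
Proof.
apply/measurable_fun_pairP; split; first exact: measurable_fst.
exact: (measurableT_comp measurable_fst measurable_snd).
Qed.

Lemma measurable_proj_Z2 : measurable_fun setT proj_Z2.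
Proof.
apply/measurable_fun_pairP; split; first exact: measurable_fst.
exact: (measurableT_comp measurable_snd measurable_snd).
Qed.

HB.instance Definition _ :=
  isMeasurableFun.Build _ _ _ _ proj_Z1 measurable_proj_Z1.
HB.instance Definition _ :=
  isMeasurableFun.Build _ _ _ _ proj_Z2 measurable_proj_Z2.

(* The coordinates of (Z * Y1) * Y2, resp. (Z * Y2) * Y1, are put back in the
   order Z, Y1, Y2. *)
Definition splits_off2 (nu2 : probability Y2 R)
    (lambda : probability (Z * (Y1 * Y2))%type R) : Prop :=
  forall A, measurable A ->
    lambda A = (distribution lambda proj_Z1 \x nu2)%E
      ((fun w : (Z * Y1) * Y2 => (w.1.1, (w.1.2, w.2))) @^-1` A).

Definition splits_off1 (nu1 : probability Y1 R)
    (lambda : probability (Z * (Y1 * Y2))%type R) : Prop :=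
  forall A, measurable A ->
    lambda A = (distribution lambda proj_Z2 \x nu1)%E
      ((fun w : (Z * Y2) * Y1 => (w.1.1, (w.2, w.1.2))) @^-1` A).

End joining_primeness.

Definition JP (R : realType) d (Z : measurableType d) (rho : probability Z R)
    (T : automorphism rho) : Prop :=
  ergodic rho T /\
  forall d1 d2 (Y1 : measurableType d1) (Y2 : measurableType d2)
    (nu1 : probability Y1 R) (nu2 : probability Y2 R)
    (S1 : automorphism nu1) (S2 : automorphism nu2)
    (lambda : probability (Z * (Y1 * Y2))%type R),
    standard_borel R Y1 -> standard_borel R Y2 ->
    weakly_mixing S1 -> weakly_mixing S2 ->
    ergodic_joining T (prod_aut S1 S2) lambda ->
    splits_off2 nu2 lambda \/ splits_off1 nu1 lambda.

Section complex_L2.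
Context (R : realType) d (X : measurableType d) (mu : {measure set X -> \bar R}).

Definition cintegral (f : X -> R[i]) : R[i] :=
  (\int[mu]_x complex.Re (f x)) +i* (\int[mu]_x complex.Im (f x)).

Definition cL2 (f : X -> R[i]) : Prop :=
  (fun x => complex.Re (f x)) \in Lfun mu 2%:E /\
  (fun x => complex.Im (f x)) \in Lfun mu 2%:E.

Definition cinner (f g : X -> R[i]) : R[i] :=
  cintegral (fun x => f x * (g x)^*).

Definition cL20 (f : X -> R[i]) : Prop :=
  cL2 f /\ forall c : R[i], cinner f (fun=> c) = 0.

End complex_L2.

Section circle.
Context (R : realType).

Definition circle := {z : R[i] | `|z| == 1}.

Definition circle_val (z : circle) : R[i] := val z.

Lemma circle_norm1 : `|1 : R[i]| == 1. Proof. by rewrite normr1. Qed.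

HB.instance Definition _ := Choice.on circle.
HB.instance Definition _ :=
  isPointed.Build circle (exist _ 1 circle_norm1).

Definition circle_coord (z : circle) : R * R :=
  (complex.Re (circle_val z), complex.Im (circle_val z)).

(* The Borel sigma-algebra of the circle as a subspace of the plane. *)
HB.instance Definition _ :=
  Measurable.copy circle (g_sigma_algebra_preimageType circle_coord).

Lemma circle_norm_mul (z w : circle) :
  `|circle_val z * circle_val w| == 1.
Proof. by rewrite normrM (eqP (valP z)) (eqP (valP w)) mulr1. Qed.

Definition circle_mul (p : circle * circle) : circle :=
  exist _ (circle_val p.1 * circle_val p.2) (circle_norm_mul p.1 p.2).

Lemma measurable_circle_mul : measurable_fun setT circle_mul.
Proof.
have mcoord : measurable_fun setT circle_coord.
  by move=> _ B mB; exists B.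
have mre : measurable_fun setT (fun z => complex.Re (circle_val z)).
  exact: (measurableT_comp measurable_fst mcoord).
have mim : measurable_fun setT (fun z => complex.Im (circle_val z)).
  exact: (measurableT_comp measurable_snd mcoord).
have mre1 := measurableT_comp mre (@measurable_fst _ _ circle circle).
have mre2 := measurableT_comp mre (@measurable_snd _ _ circle circle).
have mim1 := measurableT_comp mim (@measurable_fst _ _ circle circle).
have mim2 := measurableT_comp mim (@measurable_snd _ _ circle circle).
have mM : measurable_fun setT (circle_coord \o circle_mul).
  rewrite (_ : _ \o _ = fun p =>
    (complex.Re (circle_val p.1) * complex.Re (circle_val p.2) -
       complex.Im (circle_val p.1) * complex.Im (circle_val p.2),
     complex.Re (circle_val p.1) * complex.Im (circle_val p.2) +
       complex.Im (circle_val p.1) * complex.Re (circle_val p.2))).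
    by apply/measurable_fun_pairP; split;
      [apply: measurable_funB | apply: measurable_funD];
      apply: measurable_funM.
  apply/funext => p; rewrite /circle_coord /circle_mul /= /circle_val /=.
  by case: (\val p.1) => a b; case: (\val p.2) => c e.
move=> _ _ [B mB <-].
by rewrite !setTI -comp_preimage -[X in measurable X]setTI; exact: mM.
Qed.

HB.instance Definition _ :=
  isMeasurableFun.Build _ _ _ _ circle_mul measurable_circle_mul.

Definition convolution (l1 l2 : {finite_measure set circle -> \bar R}) :
    set circle -> \bar R :=
  pushforward (l1 \x l2)%E circle_mul.

Definition continuous_measure (l : set circle -> \bar R) : Prop :=
  forall z, l [set z] = 0%E.

End circle.

Definition mutually_singular (R : realType) d (X : measurableType d)
    (m1 m2 : set X -> \bar R) : Prop :=
  exists A, [/\ measurable A, m1 A = 0%E & m2 (~` A) = 0%E].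

Section spectral_type.
Context (R : realType) d (X : measurableType d) (mu : probability X R)
  (T : automorphism mu).

(* The n-th power of the Koopman operator f |-> f \o T. *)
Definition koopman (n : int) (f : X -> R[i]) : X -> R[i] := f \o aut_iter T n.

Definition spectral_measure (f : X -> R[i])
    (sigma : {finite_measure set (circle R) -> \bar R}) : Prop :=
  forall n : int,
    cintegral sigma (fun z => circle_val z ^ n) = cinner mu (koopman n f) f.

(* A representative sigma of the maximal spectral type on the orthocomplement
   of the constants; the type itself is the class of sigma modulo mutual
   absolute continuity. *)
Definition reduced_maximal_spectral_type
    (sigma : {finite_measure set (circle R) -> \bar R}) : Prop :=
  (forall f tau, cL20 mu f -> spectral_measure f tau -> tau `<< sigma) /\
  exists f tau, [/\ cL20 mu f, spectral_measure f tau,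
                     sigma `<< tau & tau `<< sigma].

(* Singularity depends only on the measure class, so it is tested on one
   representative of the reduced maximal spectral type. *)
Definition CS : Prop :=
  exists2 sigma, reduced_maximal_spectral_type sigma &
    forall l1 l2 : {finite_measure set (circle R) -> \bar R},
      continuous_measure l1 -> continuous_measure l2 ->
      mutually_singular sigma (convolution l1 l2).

End spectral_type.

(* Main.v *)
Require Import Defs.
From HB Require Import structures.
From mathcomp Require Import all_boot all_order all_algebra.
From mathcomp Require Import complex.
From mathcomp Require Import all_classical all_reals all_analysis.
From mathcomp Require Import measurable_realfun ring lra zify.

Set Implicit Arguments.
Unset Strict Implicit.
Unset Printing Implicit Defensive.

Import Order.TTheory GRing.Theory Num.Theory.
Import numFieldNormedType.Exports.

Local Open Scope classical_set_scope.
Local Open Scope ring_scope.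

(** Write lambda for an ergodic joining of T with S1 x S2, lambda1 and lambda2
    for its images on Z x Y1 and Z x Y2, and U for the Koopman operator.

    The heart of the proof is that the centred indicator a of a set in Z is
    orthogonal, in L^2(lambda), to the product b (x) c of the centred indicators
    of a set in Y1 and of a set in Y2 (CS_orthogonal).  Indeed the marginal of
    lambda on Y1 x Y2 is the product measure, so the spectral measure of b (x) c
    is the convolution of those of b and c; these two have no atoms because S1
    and S2 are weakly mixing, by Wiener's lemma (wiener_atomless).  The spectral
    measure of a is absolutely continuous with respect to the reduced maximal
    spectral type of T, hence singular to that convolution, and vectors with
    mutually singular spectral measures are orthogonal (singular_orthogonal).

    Expanding the product of three centred indicators, the orthogonality says
    (CS_decomposition)

      lambda + rho (x) nu1 (x) nu2 = lambda1 (x) nu2 + lambda2 (x) nu1.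

    A product of two weakly mixing systems is ergodic (ergodic_prod), so
    rho (x) nu_i and the image lambda_i of the ergodic measure lambda are two
    ergodic invariant probabilities: they are equal or mutually singular
    (ergodic_dichotomy).  If lambda1 = rho (x) nu1, the identity collapses to
    lambda = lambda2 (x) nu1, and symmetrically for lambda2.  If both pairs were
    mutually singular, there would be a set of full measure for
    rho (x) nu1 (x) nu2 on which the right-hand side vanishes, which is absurd
    (CS_splits_off).

    The spectral measures themselves have to be constructed.  Only real
    functions occur, so their spectral measures are symmetric under complex
    conjugation and are determined by the moments of the self-adjoint operator
    W = (2 + U + U^-1) / 4, whose spectrum lies in [0, 1]: a point z of the
    circle corresponds to its height (1 + Re z) / 2.  This turns the existence
    of spectral measures (herglotz) into the Hausdorff moment problem
    (hausdorff_moment), which is solved by taking a limit of the discrete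
    measures with Bernstein weights; the limit is taken on their quantile
    functions, by Helly's selection theorem, so that the limit measure is an
    image of Lebesgue measure.  For the same reason orthogonality can be proved
    with real polynomials in W, approximating the indicator of a Borel set of
    heights in L^2 of both spectral measures (polynomial_approximation). *)

(** * Integration of bounded measurable functions *)

Section bounded_measurable.
Context (R : realType) d (X : measurableType d).
Implicit Types f g : X -> R.

Definition bounded_measurable f :=
  measurable_fun setT f /\ exists M, forall x, `|f x| <= M.

Lemma bm_cst c : bounded_measurable (fun=> c).
Proof. by split; [exact: measurable_cst|exists `|c|]. Qed.

Lemma bmD f g : bounded_measurable f -> bounded_measurable g ->
  bounded_measurable (fun x => f x + g x).
Proof.
move=> [mf [M fM]] [mg [N gN]]; split; first exact: measurable_funD.
by exists (M + N) => x; rewrite (le_trans (ler_normD _ _))// lerD.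
Qed.

Lemma bmM f g : bounded_measurable f -> bounded_measurable g ->
  bounded_measurable (fun x => f x * g x).
Proof.
move=> [mf [M fM]] [mg [N gN]]; split; first exact: measurable_funM.
by exists (M * N) => x; rewrite normrM ler_pM.
Qed.

Lemma bmN f : bounded_measurable f -> bounded_measurable (fun x => - f x).
Proof.
move=> bf; have := bmM (bm_cst (- 1)) bf.
by under eq_fun do rewrite mulN1r.
Qed.

Lemma bmB f g : bounded_measurable f -> bounded_measurable g ->
  bounded_measurable (fun x => f x - g x).
Proof. by move=> bf bg; apply: bmD => //; exact: bmN. Qed.

Lemma bmX f n : bounded_measurable f -> bounded_measurable (fun x => f x ^+ n).
Proof.
move=> bf; elim: n => [|n IH]; first exact: bm_cst.
by under eq_fun do rewrite exprS; exact: bmM.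
Qed.

Lemma bm_sum I (s : seq I) (F : I -> X -> R) :
  (forall i, bounded_measurable (F i)) ->
  bounded_measurable (fun x => \sum_(i <- s) F i x).
Proof.
move=> bF; elim: s => [|i s IH].
  by under eq_fun do rewrite big_nil; exact: bm_cst.
by under eq_fun do rewrite big_cons; exact: bmD.
Qed.

Lemma bm_indic (A : set X) : measurable A ->
  bounded_measurable (\1_A : X -> R).
Proof.
move=> mA; split; first exact: measurable_indic.
by exists 1 => x; rewrite indicE; case: (x \in A); rewrite ?normr1 ?normr0.
Qed.

Lemma bm_horner (p : {poly R}) f : bounded_measurable f ->
  bounded_measurable (fun x => p.[f x]).
Proof.
move=> bf; under eq_fun do rewrite horner_coef.
by apply: bm_sum => i; apply: bmM; [exact: bm_cst|exact: bmX].
Qed.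

End bounded_measurable.

Lemma bm_comp (R : realType) d d' (X : measurableType d) (Y : measurableType d')
    (f : Y -> R) (h : X -> Y) :
  measurable_fun setT h -> bounded_measurable f -> bounded_measurable (f \o h).
Proof.
move=> mh [mf [M fM]]; split; first exact: measurableT_comp.
by exists M => x /=.
Qed.

Section integral_bounded_measurable.
Context (R : realType) d (X : measurableType d).
Variable m : {measure set X -> \bar R}.
Hypothesis mfin : (m setT < +oo)%E.
Implicit Types f g : X -> R.

Lemma bm_integrable f : bounded_measurable f -> m.-integrable setT (EFin \o f).
Proof.
move=> [mf [M fM]]; apply: measurable_bounded_integrable => //.
exists M; split; first exact: num_real.
by move=> y My x _ /=; rewrite (le_trans (fM x))// ltW.
Qed.

Lemma bm_RintegralD f g : bounded_measurable f -> bounded_measurable g ->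
  \int[m]_x (f x + g x) = \int[m]_x f x + \int[m]_x g x.
Proof. by move=> bf bg; apply: RintegralD => //; exact: bm_integrable. Qed.

Lemma bm_RintegralB f g : bounded_measurable f -> bounded_measurable g ->
  \int[m]_x (f x - g x) = \int[m]_x f x - \int[m]_x g x.
Proof. by move=> bf bg; apply: RintegralB => //; exact: bm_integrable. Qed.

Lemma bm_RintegralZ c f : bounded_measurable f ->
  \int[m]_x (c * f x) = c * \int[m]_x f x.
Proof. by move=> bf; apply: RintegralZl => //; exact: bm_integrable. Qed.

Lemma bm_Rintegral_sum I (s : seq I) (F : I -> X -> R) :
  (forall i, bounded_measurable (F i)) ->
  \int[m]_x (\sum_(i <- s) F i x) = \sum_(i <- s) \int[m]_x F i x.
Proof.
move=> bF; elim: s => [|i s IH].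
  under eq_Rintegral do rewrite big_nil.
  by rewrite Rintegral_cst// mul0r big_nil.
under eq_Rintegral do rewrite big_cons.
by rewrite bm_RintegralD//; [rewrite IH big_cons|exact: bm_sum].
Qed.

Lemma le_bm_Rintegral f g : bounded_measurable f -> bounded_measurable g ->
  (forall x, f x <= g x) -> \int[m]_x f x <= \int[m]_x g x.
Proof. by move=> bf bg fg; apply: le_Rintegral => //; exact: bm_integrable. Qed.

Lemma bm_Rintegral_indic (A : set X) : measurable A ->
  \int[m]_x \1_A x = fine (m A).
Proof. by move=> mA; rewrite /Rintegral integral_indic// setIT. Qed.

(** Uniformly bounded a.e. convergence suffices, the total mass being finite. *)
Lemma bm_cvg_Rintegral (f_ : nat -> X -> R) f (M : R) :
  (forall n, measurable_fun setT (f_ n)) -> measurable_fun setT f ->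
  (forall n x, `|f_ n x| <= M) ->
  {ae m, forall x, f_ n x @[n --> \oo] --> f x} ->
  \int[m]_x f_ n x @[n --> \oo] --> \int[m]_x f x.
Proof.
move=> mf_ mf fM ff.
have iM : m.-integrable setT (EFin \o (fun=> M)).
  exact/bm_integrable/bm_cst.
have [|||||iF _ c] := @dominated_convergence _ _ _ m setT measurableT
  (fun n => EFin \o f_ n) (EFin \o f) (EFin \o (fun=> M)).
- by move=> n; exact/measurable_EFinP.
- exact/measurable_EFinP.
- apply: filterS ff => x fx _; apply/fine_cvgP; split => //.
  exact: nearW.
- exact: iM.
- by apply: aeW => x n _ /=; rewrite lee_fin.
by apply: fine_cvg; rewrite fineK; [exact: c|exact: integrable_fin_num iF].
Qed.

End integral_bounded_measurable.

Lemma bm_Rintegral_image (R : realType) d d' (X : measurableType d)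
    (Y : measurableType d') (m : {measure set X -> \bar R})
    (m' : {measure set Y -> \bar R}) (phi : X -> Y) (f : Y -> R) :
  (m setT < +oo)%E -> measurable_fun setT phi ->
  (forall A, measurable A -> m' A = m (phi @^-1` A)) ->
  bounded_measurable f ->
  \int[m']_y f y = \int[m]_x f (phi x).
Proof.
move=> mfin mphi m'E bf; rewrite /Rintegral.
transitivity (fine (\int[pushforward m phi]_y (f y)%:E)%E).
  by congr fine; apply: eq_measure_integral => A mA _; exact: m'E.
rewrite integral_pushforward//.
  by apply/measurable_EFinP; case: bf.
exact/(bm_integrable mfin)/(bm_comp mphi bf).
Qed.

Lemma bm_Rintegral_prod (R : realType) d d' (X : measurableType d)
    (Y : measurableType d') (m1 : {finite_measure set X -> \bar R})
    (m2 : {finite_measure set Y -> \bar R}) (f : X -> R) (g : Y -> R) :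
  bounded_measurable f -> bounded_measurable g ->
  \int[(m1 \x m2)%E]_z (f z.1 * g z.2) = \int[m1]_x f x * \int[m2]_y g y.
Proof.
move=> bf bg.
have m1fin : (m1 setT < +oo)%E by exact: fin_num_fun_lty.
have m2fin : (m2 setT < +oo)%E by exact: fin_num_fun_lty.
have m12fin : ((m1 \x m2)%E setT < +oo)%E.
  by rewrite -setXTT product_measure1E// lte_mul_pinfty// ge0_fin_numE.
have bfg : bounded_measurable (fun z : X * Y => f z.1 * g z.2).
  apply: bmM.
    exact: (bm_comp (@measurable_fst _ _ X Y) bf).
  exact: (bm_comp (@measurable_snd _ _ X Y) bg).
rewrite /Rintegral -integral12_prod_meas1//; last exact: (bm_integrable m12fin bfg).
have -> : fubini_F m2 (fun z : X * Y => (f z.1 * g z.2)%:E) =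
    fun x => (\int[m2]_y g y * f x)%:E.
  apply/funext => x; rewrite /fubini_F /=.
  rewrite -[LHS]fineK.
    congr EFin; rewrite -/(\int[m2]_y (f x * g y)) bm_RintegralZ//.
    by rewrite mulrC.
  apply: integrable_fin_num => //.
  by apply: (bm_integrable m2fin); apply: bmM => //; exact: bm_cst.
rewrite -/(\int[m1]_x (\int[m2]_y g y * f x)) bm_RintegralZ//.
by rewrite mulrC.
Qed.

(** * Helly's selection theorem *)

Section helly.
Context (R : realType).

Let rational i : R := if unpickle i is Some r then ratr (r : rat) else 0.

Let rational_dense (x y : R) : x < y -> exists i, x < rational i < y.
Proof.
move=> xy.
have [||r [rxy [s _ sr]]] := @dense_rat R `]x, y[%classic.
- by exists ((x + y) / 2); rewrite /= mid_in_itvoo.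
- exact: itv_open.
exists (pickle s); rewrite /rational pickleK sr.
by move: rxy; rewrite /= in_itv.
Qed.

Lemma near_finite_coordinates (g : prod_topology (fun _ : nat => R)) (e : R) k : 0 < e ->
  nbhs g [set h : prod_topology (fun _ : nat => R) | forall i, (i < k)%N -> `|h i - g i| < e].
Proof.
move=> e0; elim: k => [|k IH].
  by apply: filterS filterT => h _ i; rewrite ltn0.
have H : nbhs g [set h : prod_topology (fun _ : nat => R) | `|h k - g k| < e].
  have -> : [set h : prod_topology (fun _ : nat => R) | `|h k - g k| < e] =
      proj k @^-1` ball (g k) e.
    by apply/seteqP; split => h /=; rewrite -ball_normE /= distrC.
  exact: (@proj_continuous nat (fun=> R) k g _ (nbhsx_ballx (g k) e e0)).
refine (filterS _ (filterI H IH)) => h [hk hlt] i; rewrite ltnS leq_eqVlt => /predU1P[->//|].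
exact: hlt.
Qed.

(** By compactness of the cube, the values at the rationals have a cluster point
    g, and a diagonal choice of indices converges to g at every rational.  The
    monotone function F is the right limit of g; it squeezes the sequence
    wherever it has no jump. *)
Lemma helly_selection (f : nat -> R -> R) :
  (forall n, nondecreasing_fun (f n)) -> (forall n x, 0 <= f n x <= 1) ->
  exists (N : nat -> nat) (F : R -> R),
    [/\ forall k, (k <= N k)%N, nondecreasing_fun F,
        forall x, 0 <= F x <= 1 &
        forall x, ~ discontinuity F x -> f (N k) x @[k --> \oo] --> F x].
Proof.
move=> ndf f01.
pose u n : prod_topology (fun=> R) := fun i : nat => f n (rational i).
have [g [g01 gu]] : exists g : prod_topology (fun=> R),
    (forall i : nat, g i \in `[0, 1]) /\ cluster (u n @[n --> \oo]) g.
  have := @tychonoff nat (fun=> R) (fun=> `[0, 1]%classic)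
    (fun=> @segment_compact _ 0 1).
  move=> /(_ (u n @[n --> \oo]) _)[|g [g01 gu]].
    by exists 0%N => // n _ i; rewrite /= in_itv; exact: f01.
  by exists g; split.
have /choice[N NP] k : exists n, (k <= n)%N /\
    forall i, (i < k)%N -> `|f n (rational i) - g i| < k.+1%:R^-1.
  have [||h [[n kn <-] hk]] := gu [set u n | n in [set n | (k <= n)%N]]
      [set h | forall i, (i < k)%N -> `|h i - g i| < k.+1%:R^-1].
  - by exists k => // n /= kn; exists n.
  - exact: near_finite_coordinates.
  - by exists n.
have fN i : f (N k) (rational i) @[k --> \oo] --> g i.
  apply/cvgrPdist_lt => e e0.
  near=> k; rewrite distrC (lt_trans ((NP k).2 _ _))//.
    by near: k; exact: nbhs_infty_gt.
  by near: k; exact: near_infty_natSinv_lt (PosNum e0).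
have g_nd i j : rational i <= rational j -> g i <= g j.
  move=> ij; apply: ler_cvg_to (fN i) (fN j) _.
  by apply: nearW => k; exact: ndf.
pose S x := [set g i | i in [set i | x < rational i]].
have S_inf x : has_inf (S x).
  split.
    have [|i /andP[xi _]] := @rational_dense x (x + 1); first by rewrite ltrDl.
    by exists (g i), i.
  by exists 0 => _ [i _ <-]; have /andP[] := g01 i.
pose F x := inf (S x).
have F_le x i : x < rational i -> F x <= g i.
  by move=> xi; apply: ge_inf; [case: (S_inf x)|exists i].
have le_F x i : rational i <= x -> g i <= F x.
  move=> ix; apply: lb_le_inf; first by case: (S_inf x).
  by move=> _ [j xj <-]; apply: g_nd; rewrite (le_trans ix)// ltW.
have F_nd : nondecreasing_fun F.
  move=> x y xy; apply: lb_le_inf; first by case: (S_inf y).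
  by move=> _ [i yi <-]; apply: F_le; exact: le_lt_trans yi.
have F01 x : 0 <= F x <= 1.
  apply/andP; split.
    apply: lb_le_inf; first by case: (S_inf x).
    by move=> _ [i _ <-]; have /andP[] := g01 i.
  have [_ [i xi _]] := (S_inf x).1.
  by rewrite (le_trans (F_le _ _ xi))//; have /andP[] := g01 i.
exists N, F; split => //; first by move=> k; have [] := NP k.
move=> x xF.
(* The one-sided limits of F at x agree. *)
have osc e : 0 < e -> exists y z, [/\ y < x, x < z & F z - F y < e].
  have Fl : cvg (F t @[t --> x^'-]).
    apply: nondecreasing_at_left_is_cvgr.
      by apply: nearW => t a b _ _; exact: F_nd.
    by apply: nearW => t; exists 1 => _ [s _ <-]; have /andP[] := F01 s.
  have Fr : cvg (F t @[t --> x^'+]).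
    apply: nondecreasing_at_right_is_cvgr.
      by apply: nearW => t a b _ _; exact: F_nd.
    by apply: nearW => t; exists 0 => _ [s _ <-]; have /andP[] := F01 s.
  have lr : lim (F t @[t --> x^'-]) = lim (F t @[t --> x^'+]).
    by apply/eqP/negPn/negP => lr; apply: xF.
  move=> e0.
  have [y [yx yl]] : exists y, y < x /\ `|lim (F t @[t --> x^'-]) - F y| < e / 2.
    near x^'- => y; exists y; split; first by near: y; exact: nbhs_left_lt.
    near: y; move/cvgrPdist_lt : Fl; apply; exact: divr_gt0.
  have [z [xz zl]] : exists z, x < z /\ `|lim (F t @[t --> x^'+]) - F z| < e / 2.
    near x^'+ => z; exists z; split; first by near: z; exact: nbhs_right_gt.
    near: z; move/cvgrPdist_lt : Fr; apply; exact: divr_gt0.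
  exists y, z; split => //; move: yl zl; rewrite lr !ltr_norml => /andP[? ?] /andP[? ?].
  lra.
apply/cvgrPdist_lt => e e0.
have e20 : 0 < e / 2 by exact: divr_gt0.
have [y [z [yx xz Fyz]]] := osc (e / 2) e20.
have [i /andP[yi ix]] := rational_dense yx.
have [j /andP[xj jz]] := rational_dense xz.
have Fyi := F_le _ _ yi; have Fjz := le_F _ _ (ltW jz).
have Fyx := F_nd _ _ (ltW yx); have Fxz := F_nd _ _ (ltW xz).
near=> k.
have fi : `|g i - f (N k) (rational i)| < e / 2.
  by near: k; move/cvgrPdist_lt : (fN i); apply.
have fj : `|g j - f (N k) (rational j)| < e / 2.
  by near: k; move/cvgrPdist_lt : (fN j); apply.
have fix_ := ndf (N k) _ _ (ltW ix); have fxj := ndf (N k) _ _ (ltW xj).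
move: fi fj; rewrite !ltr_norml => /andP[? ?] /andP[? ?]; apply/andP; split; lra.
Unshelve. all: by end_near. Qed.

End helly.

(** * The Hausdorff moment problem *)

Lemma mul_bin_ffact n i j :
  ('C(n + j, i + j) * (i + j) ^_ j = (n + j) ^_ j * 'C(n, i))%N.
Proof.
elim: j => [|j IH]; first by rewrite !addn0 !ffactn0 muln1 mul1n.
rewrite !addnS !ffactSS mulnA [('C(_, _) * _)%N]mulnC -mul_bin_diag.
by rewrite /= -mulnA IH mulnA.
Qed.

(** The ratios of falling factorials are the functions of k whose Bernstein
    means are exactly the monomials; for large n they are uniformly close to the
    powers of k / n. *)
Lemma ffact_ratio_approx (R : realFieldType) n k j : (0 < n)%N ->
  (k <= n)%N -> (j <= n)%N ->
  `|(k ^_ j)%:R / (n ^_ j)%:R - (k%:R / n%:R) ^+ j| <= (j * j)%:R / n%:R :> R.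
Proof.
move=> n0 kn.
have nR0 : 0 < n%:R :> R by rewrite ltr0n.
have knR : 0 <= (k%:R / n%:R : R) <= 1.
  by rewrite divr_ge0 ?ler0n//= ler_pdivrMr// mul1r ler_nat.
elim: j => [_|j IH jn].
  by rewrite !ffactn0 expr0 divr1 subrr normr0 mul0n mul0r.
have {IH} := IH (ltnW jn).
have njR0 : 0 < (n - j)%:R :> R by rewrite ltr0n subn_gt0.
rewrite !ffactnSr (natrM _ (k ^_ j)) (natrM _ (n ^_ j)) exprS invfM.
set a : R := (k ^_ j)%:R / (n ^_ j)%:R; set b := (_ / _) ^+ j.
have -> : (k ^_ j)%:R * (k - j)%:R * ((n ^_ j)%:R^-1 / (n - j)%:R) =
  a * ((k - j)%:R / (n - j)%:R) :> R by rewrite /a mulrACA.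
have a01 : 0 <= a <= 1.
  rewrite /a divr_ge0 ?ler0n//= ler_pdivrMr ?ltr0n ?ffact_gt0 1?ltnW//.
  by rewrite mul1r ler_nat !ffact_prod leq_prod// => i _; rewrite leq_sub2r.
have b01 : 0 <= b <= 1.
  by case/andP: knR => k0 k1; rewrite /b exprn_ge0//= exprn_ile1.
have step : `|(k - j)%:R / (n - j)%:R - k%:R / n%:R| <= j%:R / n%:R :> R.
  have [kj|jk] := leqP k j.
    rewrite (eqP kj) mul0r sub0r normrN ger0_norm; last by case/andP: knR.
    by rewrite ler_pM2r ?invr_gt0// ler_nat.
  have -> : (k - j)%:R / (n - j)%:R - k%:R / n%:R =
      - (j%:R / n%:R * ((n - k)%:R / (n - j)%:R)) :> R.
    rewrite !natrB ?(ltnW jk) ?(ltnW jn)//.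
    field; rewrite -natrB ?(ltnW jn)// !lt0r_neq0//.
  rewrite normrN ger0_norm ?mulr_ge0 ?invr_ge0 ?ler0n//.
  rewrite ler_piMr ?divr_ge0 ?ler0n// ler_pdivrMr// mul1r ler_nat.
  by rewrite leq_sub2l// ltnW.
move: knR step; set c := k%:R / n%:R; set e := _ / (n - j)%:R => /andP[c0 c1] step IH.
have -> : a * e - c * b = a * (e - c) + c * (a - b) by ring.
rewrite (le_trans (ler_normD _ _))// (normrM a) (normrM c).
case/andP: a01 => a0 a1; rewrite (ger0_norm a0) (ger0_norm c0).
have h1 : a * `|e - c| <= j%:R / n%:R by rewrite (le_trans _ step)// ler_piMl.
have h2 : c * `|a - b| <= (j * j)%:R / n%:R by rewrite (le_trans _ IH)// ler_piMl.
rewrite (le_trans (lerD h1 h2))// -mulrDl ler_pM2r ?invr_gt0// -natrD ler_nat.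
nia.
Qed.

Section quantile.
Context (R : realType) (m : nat -> R).
Hypothesis m_ge0 : forall k, 0 <= m k.

Let S k := \sum_(i < k) m i.

Let S_nd : {homo S : j k / (j <= k)%N >-> j <= k}.
Proof.
apply: homo_leq => [//|x y z|k]; first exact: le_trans.
by rewrite /S big_ord_recr lerDl.
Qed.

(** On [0, m_0 + ... + m_n[, the quantile function of the measure on {0, ..., n}
    with weights m: its law under Lebesgue measure is that measure. *)
Definition quantile n (x : R) : nat := (\sum_(k < n) (S k.+1 <= x)%R)%N.

Lemma quantile_le n x : (quantile n x <= n)%N.
Proof.
rewrite /quantile -[leqRHS]card_ord -sum1_card.
by apply: leq_sum => i _; exact: leq_b1.
Qed.

Lemma quantile_nd n x y : x <= y -> (quantile n x <= quantile n y)%N.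
Proof.
move=> xy; apply: leq_sum => i _; case: (leP (S i.+1) x) => //= Sx.
by rewrite (le_trans Sx xy).
Qed.

(** Written in this form, the composition with G is a sum of indicators of
    half-lines for every x, also outside the interval that carries the mass. *)
Lemma quantile_telescope (G : nat -> R) n x : G (quantile n x) =
  G 0%N + \sum_(k < n) (G k.+1 - G k) * \1_[set y | S k.+1 <= y] x.
Proof.
elim: n => [|n IH]; first by rewrite /quantile !big_ord0 addr0.
rewrite big_ord_recr /= addrA -IH /quantile big_ord_recr /=.
have -> : \1_[set y | S n.+1 <= y] x = (S n.+1 <= x)%R%:R :> R.
  by rewrite indicE; congr ((nat_of_bool _)%:R); apply/idP/idP; rewrite inE.
case: (leP (S n.+1) x) => /= Sx; last by rewrite addn0 mulr0 addr0.
have -> : (\sum_(k < n) (S k.+1 <= x)%R)%N = n.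
  rewrite -[RHS]card_ord -sum1_card; apply: eq_bigr => i _.
  by rewrite (le_trans _ Sx)// S_nd// ltnS ltnW.
by rewrite addn1 mulr1 addrC subrK.
Qed.

Let abel (G : nat -> R) M n :
  G 0%N * M + \sum_(k < n) (G k.+1 - G k) * (M - S k.+1) =
  \sum_(k < n) m k * G k + G n * (M - S n).
Proof.
elim: n => [|n IH]; first by rewrite !big_ord0 /S big_ord0; ring.
rewrite !big_ord_recr/= addrA IH /S big_ord_recr /=; ring.
Qed.

Lemma integral_quantile (m0 : {measure set (measurableTypeR R) -> \bar R}) (G : nat -> R) n :
  (forall s, 0 <= s <= S n.+1 ->
    m0 [set y | s <= y] = (S n.+1 - s)%:E) ->
  m0 setT = (S n.+1)%:E ->
  \int[m0]_x G (quantile n x) = \sum_(k < n.+1) m k * G k.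
Proof.
move=> m0E m0T; have m0fin : (m0 setT < +oo)%E by rewrite m0T ltry.
have mS s : measurable [set y : measurableTypeR R | s <= y].
  have -> : [set y : R | s <= y] = `[s, +oo[%classic.
    by apply/seteqP; split => y; rewrite /= in_itv /= andbT.
  exact: measurable_itv.
under eq_Rintegral do rewrite quantile_telescope.
rewrite bm_RintegralD//; [|exact: bm_cst|]; last first.
  by apply: bm_sum => k; apply: bmM; [exact: bm_cst|exact: bm_indic].
rewrite bm_Rintegral_sum//; last first.
  by move=> k; apply: bmM; [exact: bm_cst|exact: bm_indic].
rewrite Rintegral_cst// m0T /=.
transitivity (G 0%N * S n.+1 + \sum_(k < n) (G k.+1 - G k) * (S n.+1 - S k.+1)).
  congr (_ + _); apply: eq_bigr => k _.
  rewrite bm_RintegralZ//; last exact: bm_indic.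
  rewrite bm_Rintegral_indic// m0E//.
  by rewrite sumr_ge0//= S_nd// ltnS ltnW.
have SS : S n.+1 = S n + m n by rewrite /S big_ord_recr.
by rewrite abel big_ord_recr /= SS addrAC subrr add0r mulrC.
Qed.

End quantile.

(** Since C(n, k) k^_j = n^_j C(n - j, k - j), this is the binomial formula for
    (1 - X) + X. *)
Lemma bernstein_ffact (R : comNzRingType) n j : (j <= n)%N ->
  \sum_(k < n.+1) ('C(n, k) * k ^_ j)%:R *: ('X^k * (1 - 'X) ^+ (n - k)) =
  (n ^_ j)%:R *: 'X^j :> {poly R}.
Proof.
move=> /subnK <-; move: (n - j)%N => {}n.
rewrite -(big_mkord xpredT (fun k => ('C(n + j, k) * k ^_ j)%:R *:
   ('X^k * (1 - 'X) ^+ (n + j - k)) : {poly R})).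
rewrite (@big_cat_nat _ _ _ j)//=; last by rewrite ltnW// ltnS leq_addl.
rewrite big_nat big1 ?add0r; last first.
  by move=> k /andP[_ kj]; rewrite ffact_small// muln0 scale0r.
rewrite -{1}[j]add0n big_addn -addSn addnK big_mkord.
transitivity (((n + j) ^_ j)%:R *: ('X^j * ((1 - 'X) + 'X) ^+ n) : {poly R}); last first.
  by rewrite subrK expr1n mulr1.
rewrite exprDn mulr_sumr scaler_sumr; apply: eq_bigr => i _.
rewrite mul_bin_ffact natrM -scalerA; congr (_ *: _).
by rewrite scaler_nat subnDr mulrnAr exprD; congr (_ *+ _); ring.
Qed.

Section hausdorff_moment.
Context (R : realType) (L : {poly R} -> R).
Hypothesis L_lin : forall c p q, L (c *: p + q) = c * L p + L q.
Hypothesis L_sq : forall p, 0 <= L (p ^+ 2).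
Hypothesis L_Xsq : forall p, 0 <= L ('X * p ^+ 2).
Hypothesis L_1Xsq : forall p, 0 <= L ((1 - 'X) * p ^+ 2).

Let L0 : L 0 = 0.
Proof. by have := L_lin (-1) 0 0; rewrite scaler0 addr0 mulN1r addNr. Qed.

Let LZ c p : L (c *: p) = c * L p.
Proof. by have := L_lin c p 0; rewrite !addr0 L0 addr0. Qed.

Let LD p q : L (p + q) = L p + L q.
Proof. by have := L_lin 1 p q; rewrite scale1r mul1r. Qed.

Let L_sum I (s : seq I) (F : I -> {poly R}) :
  L (\sum_(i <- s) F i) = \sum_(i <- s) L (F i).
Proof.
elim: s => [|i s IH]; first by rewrite !big_nil.
by rewrite !big_cons LD IH.
Qed.

(** Up to a square, the exponents are 0 or 1, and
    X (1 - X) = X (1 - X)^2 + (1 - X) X^2. *)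
Let L_bernstein_ge0 k l : 0 <= L ('X^k * (1 - 'X) ^+ l).
Proof.
rewrite -(odd_double_half k) -(odd_double_half l) -!muln2 !exprD !exprM.
set p := 'X^(k./2); set q := (1 - 'X) ^+ l./2.
case: (odd k); case: (odd l) => /=; rewrite ?expr0 ?expr1.
- have -> : 'X * p ^+ 2 * ((1 - 'X) * q ^+ 2) =
    'X * (p * q * (1 - 'X)) ^+ 2 + (1 - 'X) * (p * q * 'X) ^+ 2 by ring.
  by rewrite LD addr_ge0.
- by rewrite mul1r -mulrA -exprMn.
- by rewrite mul1r mulrCA -exprMn.
- by rewrite !mul1r -exprMn.
Qed.

Let m n k : R := 'C(n, k)%:R * L ('X^k * (1 - 'X) ^+ (n - k)).

Let m_ge0 n k : 0 <= m n k.
Proof. by rewrite mulr_ge0. Qed.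

Let m_ffact n j : (j <= n)%N ->
  \sum_(k < n.+1) m n k * ((k ^_ j)%:R / (n ^_ j)%:R) = L 'X^j.
Proof.
move=> jn.
have nj0 : (n ^_ j)%:R != 0 :> R by rewrite pnatr_eq0 -lt0n ffact_gt0.
apply: (mulfI nj0); rewrite -LZ -bernstein_ffact// L_sum mulr_sumr.
apply: eq_bigr => k _; rewrite LZ /m natrM; field.
exact: nj0.
Qed.

Let m_total n : \sum_(k < n.+1) m n k = L 1.
Proof.
rewrite -(expr0 'X) -(m_ffact (leq0n n)).
by apply: eq_bigr => k _; rewrite !ffactn0 divr1 mulr1.
Qed.

Let m_moment j : \sum_(k < n.+2) m n.+1 k * (k%:R / n.+1%:R) ^+ j @[n --> \oo]
  --> L 'X^j.
Proof.
apply/cvgrPdist_le => e e0.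
near=> n.
have jn : (j <= n.+1)%N by rewrite leqW//; near: n; exact: nbhs_infty_ge.
rewrite -(m_ffact jn) -sumrB.
rewrite (le_trans (ler_norm_sum _ _ _))//.
have bound : \sum_(k < n.+2) m n.+1 k * ((j * j)%:R / n.+1%:R) <= e.
  rewrite -mulr_suml m_total mulrA ler_pdivrMr//.
  rewrite -ler_pdivrMl//.
  have : e^-1 * (L 1 * (j * j)%:R) <= n%:R.
    by near: n; exact: nbhs_infty_ger.
  by move=> /le_trans -> //; rewrite ler_nat.
apply: le_trans bound; apply: ler_sum => k _.
rewrite -mulrBr normrM ger0_norm// ler_wpM2l//.
by apply: ffact_ratio_approx => //; rewrite -ltnS.
Unshelve. all: by end_near. Qed.

(** The weights m n k give discrete measures on the points k / n whose moments
    converge to those of L.  Their quantile functions are monotone, so a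
    subsequence converges off a countable set, and bounded convergence carries
    the moments over to the limit q. *)
Lemma hausdorff_moment : exists (m0 : {finite_measure set (measurableTypeR R) -> \bar R}) (q : R -> R),
  [/\ measurable_fun setT q, forall x, 0 <= q x <= 1 &
      forall p, \int[m0]_x p.[q x] = L p].
Proof.
have M0 : 0 <= L 1 by have := L_sq 1; rewrite expr1n.
pose D : set (measurableTypeR R) := `[0, L 1]%classic.
have mD : measurable D by exact: measurable_itv.
have Dfin : (lebesgue_measure D < +oo)%E.
  by rewrite lebesgue_measure_itv /= lte_fin; case: ifP; rewrite ?ltry// -EFinB ltry.
pose m0 : {finite_measure set (measurableTypeR R) -> \bar R} := mfrestr mD Dfin.
have m0E A : m0 A = lebesgue_measure (A `&` D) by [].
have m0T : m0 setT = (L 1)%:E.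
  rewrite m0E setTI lebesgue_measure_itv /= lte_fin; case: ltP => [_|M0'].
    by rewrite sube0.
  by congr EFin; apply/eqP; rewrite eq_le M0.
have m0fin : (m0 setT < +oo)%E by rewrite m0T ltry.
have m0S s : 0 <= s <= L 1 -> m0 [set y | s <= y] = (L 1 - s)%:E.
  move=> /andP[s0 sM]; rewrite m0E.
  have -> : [set y | s <= y] `&` D = `[s, L 1]%classic.
    apply/seteqP; split => y; rewrite /D /= !in_itv /=.
      by move=> [sy /andP[_ yM]]; apply/andP.
    by move=> /andP[sy yM]; split=> //; apply/andP; rewrite (le_trans s0 sy).
  rewrite lebesgue_measure_itv /= lte_fin; case: ltP => [_|Ms].
    by rewrite EFinB.
  by congr EFin; apply/eqP; rewrite eq_sym subr_eq0 eq_le sM Ms.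
pose f n x : R := (quantile (m n.+1) n.+1 x)%:R / n.+1%:R.
have f_nd n : nondecreasing_fun (f n).
  move=> x y xy; rewrite ler_pM2r ?invr_gt0// ler_nat; exact: quantile_nd.
have f01 n x : 0 <= f n x <= 1.
  rewrite divr_ge0//= ler_pdivrMr// mul1r ler_nat; exact: quantile_le.
have [N [q [N_ge q_nd q01 fq]]] := helly_selection f_nd f01.
have mq : measurable_fun setT q by exact: nondecreasing_measurable.
have bq : bounded_measurable q.
  by split=> //; exists 1 => x; have /andP[? ?] := q01 x; rewrite ger0_norm.
have f_moment n j : \int[m0]_x f n x ^+ j =
    \sum_(k < n.+2) m n.+1 k * (k%:R / n.+1%:R) ^+ j.
  apply: (integral_quantile (m_ge0 n.+1) (m0 := m0)
    (fun k => (k%:R / n.+1%:R) ^+ j)); rewrite m_total//.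
have ae_cvg : {ae m0, forall x, f (N k) x @[k --> \oo] --> q x}.
  pose C := [set x | x \in (`]0, L 1[) /\ discontinuity q x] `|` [set 0; L 1].
  have cC : countable C.
    rewrite /C -bigcup2E; apply: bigcup_countable => // -[|[|i]] _ /=; last 2 first.
    - exact: finite_set_countable.
    - exact: countable0.
    by apply: discontinuity_countable => x y _ _; exact: q_nd.
  have mC : measurable C by exact: countable_measurable.
  exists (C `|` ~` D); split.
  - by apply: measurableU => //; exact: measurableC.
  - rewrite m0E setIUl setICl setU0; apply: countable_lebesgue_measure0.
    exact: sub_countable (subset_card_le (@subIsetl _ _ _)) cC.
  - move=> x /= ncvg; have [xD|] := pselect (x \in `[0, L 1]); last by right.
    left; rewrite /C /=.
    have [x0|x0] := eqVneq x 0; first by right; left.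
    have [xM|xM] := eqVneq x (L 1); first by right; right.
    left; split.
      move: xD; rewrite !in_itv /= => /andP[? ?].
      by rewrite !lt_neqAle eq_sym x0 xM; apply/andP.
    by apply: contrapT => /fq.
have q_moment j : \int[m0]_x q x ^+ j = L 'X^j.
  have c1 : \int[m0]_x f (N k) x ^+ j @[k --> \oo] --> \int[m0]_x q x ^+ j.
    apply: (@bm_cvg_Rintegral _ _ _ m0 m0fin _ _ 1).
    - move=> k; apply: measurable_funX; exact: nondecreasing_measurable.
    - exact: measurable_funX.
    - move=> k x; have /andP[? ?] := f01 (N k) x.
      by rewrite ger0_norm ?exprn_ge0// exprn_ile1.
    - case: ae_cvg => A [mA A0 sA]; exists A; split => //.
      apply: subset_trans sA => x /= ncvg fNq; apply: ncvg.
      exact: (@cvg_comp _ _ _ (fun k => f (N k) x) (fun y : R => y ^+ j) _ _ _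
        fNq (@exprn_continuous R j (q x))).
  have c2 : \int[m0]_x f (N k) x ^+ j @[k --> \oo] --> L 'X^j.
    under eq_fun do rewrite f_moment.
    apply: (cvg_comp _ _ _ (@m_moment j)).
    apply/cvgnyPge => B; exists B => // k /= Bk.
    exact: leq_trans (N_ge k).
  exact: (cvg_unique _ c1 c2).
exists m0, q; split => // p.
rewrite -{2}[p]coefK poly_def.
under eq_Rintegral do rewrite horner_coef.
rewrite bm_Rintegral_sum//; last first.
  by move=> i; apply: bmM; [exact: bm_cst|exact: bmX].
rewrite L_sum; apply: eq_bigr => i _; rewrite LZ -q_moment.
by rewrite bm_RintegralZ//; exact: bmX.
Qed.

End hausdorff_moment.

(** * Polynomial approximation of indicators *)

Section sign_iteration.
Context (R : realType).

(** The odd cubic (3x - x^3)/2 fixes -1, 0 and 1, and pushes every other point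
    of [-1, 1] towards the endpoint of its own sign. *)
Definition sign_step (v : R) := (3 * v - v ^+ 3) / 2.

Let sign_step_itv v : 0 < v <= 1 -> v <= sign_step v <= 1.
Proof.
rewrite /sign_step => /andP[v0 v1]; apply/andP; split.
  have : 0 <= v * (1 - v) * (1 + v) by rewrite !mulr_ge0//; lra.
  lra.
have : 0 <= (1 - v) ^+ 2 * (2 + v) by rewrite mulr_ge0 ?sqr_ge0//; lra.
lra.
Qed.

Let iter_sign_step_itv n v : 0 < v <= 1 -> v <= iter n sign_step v <= 1.
Proof.
move=> v01; elim: n => [|n /andP[IH IH1]] /=.
  by case/andP: v01 => _ ->; rewrite lexx.
have /andP[v0 _] := v01.
have /sign_step_itv/andP[h ->] : 0 < iter n sign_step v <= 1.
  by rewrite (lt_le_trans v0 IH).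
by rewrite (le_trans IH h).
Qed.

Let iter_sign_step_pos v : 0 < v <= 1 -> iter n sign_step v @[n --> \oo] --> (1 : R).
Proof.
move=> v01; have /andP[v0 v1] := v01.
(* One step multiplies 1 - y by (1 - y) (2 + y) / 2, which is at most
   1 - y / 2, and the iterates stay above v. *)
have bound n : 0 <= 1 - iter n sign_step v <= (1 - v / 2) ^+ n.
  elim: n => [|n /andP[IH0 IH]] /=; first by rewrite expr0; lra.
  have /andP[nv n1] := iter_sign_step_itv n v01.
  have /andP[_ n1'] := iter_sign_step_itv n.+1 v01.
  apply/andP; split; first by move: n1' => /=; lra.
  move: nv n1 IH0 IH; set y := iter n _ _ => nv n1 y0 yn; rewrite exprSr.
  apply: (@le_trans _ _ ((1 - y) * (1 - v / 2))); last first.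
    by rewrite ler_wpM2r//; lra.
  have -> : 1 - sign_step y = (1 - y) * ((1 - y) * (2 + y) / 2).
    by rewrite /sign_step; field.
  rewrite ler_wpM2l//.
  have : 0 <= y ^+ 2 by exact: sqr_ge0.
  lra.
have geo : (1 - v / 2) ^+ n @[n --> \oo] --> (0 : R).
  by apply: cvg_expr; rewrite ger0_norm; lra.
have : (1 - iter n sign_step v) @[n --> \oo] --> (0 : R).
  apply: squeeze_cvgr (cvg_cst 0) geo.
  exact: nearW.
move=> /(cvgB (cvg_cst (1 : R))); rewrite subr0; apply: cvg_trans.
by apply: near_eq_cvg; apply: nearW => n /=; rewrite opprB addrC subrK.
Qed.

Let iter_sign_stepN n v : iter n sign_step (- v) = - iter n sign_step v.
Proof. by elim: n => //= n ->; rewrite /sign_step; field. Qed.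

Let iter_sign_step0 n : iter n sign_step 0 = 0.
Proof. by elim: n => //= n ->; rewrite /sign_step; field. Qed.

Lemma iter_sign_step_norm n v : `|v| <= 1 -> `|iter n sign_step v| <= 1.
Proof.
have pos w : 0 < w <= 1 -> `|iter n sign_step w| <= 1.
  move=> w01; have /andP[w0 _] := w01.
  have /andP[h1 h2] := iter_sign_step_itv n w01.
  by rewrite ger0_norm// (le_trans (ltW w0)).
have [v0|v0|->] := ltgtP v 0.
- by rewrite ltr0_norm// => v1; rewrite -[v]opprK iter_sign_stepN normrN pos// v1 oppr_gt0 v0.
- by rewrite gtr0_norm// => v1; rewrite pos// v0.
- by rewrite iter_sign_step0.
Qed.

(** (y^2 + y) / 2 takes the values 0, 0 and 1 at -1, 0 and 1. *)
Lemma cvg_iter_sign_step v : `|v| <= 1 ->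
  let y n := iter n sign_step v in
  (y n ^+ 2 + y n) / 2 @[n --> \oo] --> ((0 < v)%R%:R : R).
Proof.
move=> v1 y.
suff [l yl <-] : exists2 l : R, y n @[n --> \oo] --> l & (l ^+ 2 + l) / 2 = (0 < v)%R%:R.
  by apply: cvgMl; apply: cvgD => //; exact: cvgM.
move: v1; rewrite /y; have [v0|v0|->] := ltgtP v 0.
- rewrite ltr0_norm// => v1; exists (- 1); last by rewrite sqrrN expr1n subrr mul0r.
  rewrite -[v]opprK; under eq_fun do rewrite iter_sign_stepN.
  by apply: cvgN; apply: iter_sign_step_pos; rewrite oppr_gt0 v0.
- rewrite gtr0_norm// => v1; exists 1; last by rewrite expr1n divff.
  by apply: iter_sign_step_pos; rewrite v0.
- move=> _; exists 0; last by rewrite expr0n addr0 mul0r.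
  by under eq_fun do rewrite iter_sign_step0; exact: cvg_cst.
Qed.

Definition sign_poly (p : {poly R}) n : {poly R} :=
  iter n (fun q => 2^-1 *: (3 *: q - q ^+ 3)) p.

Lemma horner_sign_poly p n u : (sign_poly p n).[u] = iter n sign_step p.[u].
Proof.
elim: n => //= n IH.
by rewrite !hornerE IH /sign_step mulrC.
Qed.

End sign_iteration.

Section polynomial_approximation.
Context (R : realType) d1 d2 (X1 : measurableType d1) (X2 : measurableType d2).
Variables (m1 : {measure set X1 -> \bar R}) (m2 : {measure set X2 -> \bar R}).
Hypotheses (m1fin : (m1 setT < +oo)%E) (m2fin : (m2 setT < +oo)%E).
Variables (u1 : X1 -> R) (u2 : X2 -> R).
Hypotheses (mu1 : measurable_fun setT u1) (mu2 : measurable_fun setT u2).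
Hypotheses (u1_01 : forall x, 0 <= u1 x <= 1) (u2_01 : forall x, 0 <= u2 x <= 1).

Let err d (X : measurableType d) (m : {measure set X -> \bar R}) (u : X -> R)
  (p : {poly R}) (G : set R) := \int[m]_x (p.[u x] - \1_G (u x)) ^+ 2.

Let approximable (G : set R) := forall e, 0 < e ->
  exists p, err m1 u1 p G < e /\ err m2 u2 p G < e.

Section one_measure.
Context d (X : measurableType d) (m : {measure set X -> \bar R}) (u : X -> R).
Hypotheses (mfin : (m setT < +oo)%E) (mu : measurable_fun setT u)
  (u01 : forall x, 0 <= u x <= 1).

Let bu : bounded_measurable u.
Proof.
by split=> //; exists 1 => x; have /andP[? ?] := u01 x; rewrite ger0_norm.
Qed.

Let b1 G : measurable G -> bounded_measurable (fun x => \1_G (u x) : R).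
Proof. by move=> mG; exact: (bm_comp mu (bm_indic R mG)). Qed.

Let berr p G : measurable G ->
  bounded_measurable (fun x => (p.[u x] - \1_G (u x)) ^+ 2).
Proof. by move=> mG; apply: bmX; apply: bmB; [exact: bm_horner|exact: b1]. Qed.

Lemma errT : err m u 1 setT = 0.
Proof.
rewrite /err; under eq_Rintegral do rewrite hornerC indicT subrr expr0n /=.
by rewrite Rintegral_cst// mul0r.
Qed.

Lemma errC p G : err m u (1 - p) (~` G) = err m u p G.
Proof.
apply: eq_Rintegral => x _; rewrite !hornerE !indicE in_setC.
by case: (_ \in G) => /=; ring.
Qed.

Lemma errU p q A B : measurable A -> measurable B -> A `&` B = set0 ->
  err m u (p + q) (A `|` B) <= 2 * err m u p A + 2 * err m u q B.
Proof.
move=> mA mB AB.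
have bA := berr p mA; have bB := berr q mB.
have bA2 := bmM (bm_cst X (2 : R)) bA; have bB2 := bmM (bm_cst X (2 : R)) bB.
rewrite /err -(bm_RintegralZ mfin 2 bA) -(bm_RintegralZ mfin 2 bB).
rewrite -bm_RintegralD//.
apply: le_bm_Rintegral => //; first by apply: berr; exact: measurableU.
  exact: bmD.
move=> x.
have -> : \1_(A `|` B) (u x) = \1_A (u x) + \1_B (u x) :> R.
  rewrite !indicE in_setU; case: (boolP (_ \in A)) => xA; last by rewrite add0r.
  case: (boolP (_ \in B)) => xB; last by rewrite addr0.
  have : (A `&` B) (u x) by split; apply: set_mem.
  by rewrite AB.
rewrite hornerD.
set a := p.[u x] - _; set b := q.[u x] - \1_B (u x).
have -> : p.[u x] + q.[u x] - (\1_A (u x) + \1_B (u x)) = a + b.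
  by rewrite /a /b; ring.
have := sqr_ge0 (a - b); lra.
Qed.

Lemma err_tri p A B : measurable A -> measurable B ->
  err m u p B <= 2 * err m u p A + 2 * \int[m]_x (\1_A (u x) - \1_B (u x)) ^+ 2.
Proof.
move=> mA mB.
have bAB : bounded_measurable (fun x => (\1_A (u x) - \1_B (u x) : R) ^+ 2).
  by apply: bmX; apply: bmB; exact: b1.
have bA := berr p mA.
have bA2 := bmM (bm_cst X (2 : R)) bA; have bAB2 := bmM (bm_cst X (2 : R)) bAB.
rewrite /err -(bm_RintegralZ mfin 2 bA) -(bm_RintegralZ mfin 2 bAB).
rewrite -bm_RintegralD//.
apply: le_bm_Rintegral => //; first exact: berr.
  exact: bmD.
move=> x; set a : R := \1_A (u x); set b : R := \1_B (u x).
have := sqr_ge0 (p.[u x] - a - (a - b)); lra.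
Qed.

Lemma cvg_indic_bigcup (F : nat -> set R) : (forall n, measurable (F n)) ->
  \int[m]_x (\1_(\big[setU/set0]_(k < n) F k) (u x) - \1_(\bigcup_k F k) (u x)) ^+ 2
  @[n --> \oo] --> (0 : R).
Proof.
move=> mF.
have mU : measurable (\bigcup_k F k) by exact: bigcup_measurable.
have mUn n : measurable (\big[setU/set0]_(k < n) F k).
  exact: bigsetU_measurable.
rewrite -[X in _ --> X](_ : \int[m]_x (fun=> 0 : R) x = 0); last first.
  by rewrite Rintegral_cst// mul0r.
apply: (bm_cvg_Rintegral mfin (M := 1)).
- move=> n; have [//] : bounded_measurable (fun x =>
    (\1_(\big[setU/set0]_(k < n) F k) (u x) - \1_(\bigcup_k F k) (u x) : R) ^+ 2).
  by apply: bmX; apply: bmB; exact: b1.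
- exact: measurable_cst.
- move=> n x; rewrite !indicE.
  by case: (_ \in _); case: (_ \in _); rewrite ?subrr ?subr0 ?sub0r ?sqrrN ?expr1n ?expr0n ?normr0 ?normr1.
apply: aeW => x.
have [[k _ Fk]|nF] := pselect ((\bigcup_k F k) (u x)).
  apply: cvg_near_cst.
  exists k.+1 => // n /= kn.
  rewrite !indicE !mem_set ?subrr ?expr0n//; first by exists k.
  by rewrite -bigcup_mkord; exists k.
apply: cvg_near_cst.
apply: nearW => n; rewrite !indicE !memNset ?subrr ?expr0n//.
rewrite -bigcup_mkord => -[k _ Fk]; apply: nF; by exists k.
Qed.

(** The factor 1 / (1 + |t|) brings u - t into [-1, 1], where the iteration
    computes signs. *)
Lemma err_halfline t :
  let K := 1 + `|t| in
  let p n : {poly R} := sign_poly (K^-1 *: ('X - t%:P)) n in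
  err m u (2^-1 *: (p n ^+ 2 + p n)) [set y | t < y] @[n --> \oo] --> (0 : R).
Proof.
move=> K p; have K0 : 0 < K by rewrite ltr_wpDr.
have mG : measurable [set y : R | t < y].
  have -> : [set y : R | t < y] = `]t, +oo[%classic.
    by apply/seteqP; split => y; rewrite /= in_itv /= andbT.
  exact: measurable_itv.
pose v x := K^-1 * (u x - t).
have v1 x : `|v x| <= 1.
  rewrite /v normrM gtr0_norm ?invr_gt0// ler_pdivrMl// mulr1.
  rewrite (le_trans (ler_normB _ _))// lerD2r.
  by have /andP[? ?] := u01 x; rewrite ger0_norm.
have pE n x : (2^-1 *: (p n ^+ 2 + p n)).[u x] =
    ((iter n (@sign_step R) (v x)) ^+ 2 + iter n (@sign_step R) (v x)) / 2.
  by rewrite hornerZ hornerD horner_exp /p horner_sign_poly !hornerE mulrC.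
rewrite -[X in _ --> X](_ : \int[m]_x (fun=> 0 : R) x = 0); last first.
  by rewrite Rintegral_cst// mul0r.
apply: (bm_cvg_Rintegral mfin (M := 4)).
- by move=> n; have [] := berr (2^-1 *: (p n ^+ 2 + p n)) mG.
- exact: measurable_cst.
- move=> n x; rewrite pE; have := iter_sign_step_norm n (v1 x).
  set y := iter _ _ _; rewrite ler_norml => /andP[y1 y2].
  have : 0 <= (1 - y) * (1 + y) by rewrite mulr_ge0//; lra.
  have := sqr_ge0 y; rewrite normrX => y0 y3.
  rewrite -[4](_ : 2 ^+ 2 = 4 :> R); last by rewrite -natrX.
  rewrite lerXn2r ?nnegrE// ler_norml indicE; case: (_ \in _) => /=; apply/andP; split; lra.
apply: aeW => x.
under eq_fun do rewrite pE.
have -> : \1_[set y | t < y] (u x) = (0 < v x)%R%:R :> R.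
  rewrite indicE; congr ((nat_of_bool _)%:R).
  rewrite /v pmulr_rgt0 ?invr_gt0// subr_gt0.
  by apply/idP/idP; rewrite inE.
set b : R := (0 < v x)%R%:R.
have c : (iter n (@sign_step R) (v x) ^+ 2 + iter n (@sign_step R) (v x)) / 2 - b
    @[n --> \oo] --> 0.
  rewrite -(subrr b); apply: cvgB; last exact: cvg_cst.
  exact: cvg_iter_sign_step.
have := @cvg_comp _ _ _ _ (fun y : R => y ^+ 2) _ _ _ c (@exprn_continuous R 2 0).
by rewrite expr0n.
Qed.

End one_measure.

(** Half-lines are limits of iterated sign polynomials, and the sets whose
    indicator is approximable form a Dynkin class.  Two measure spaces are
    handled at once because the same polynomial must serve for both. *)
Lemma polynomial_approximation G : measurable G -> approximable G.
Proof.
move=> mG.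
have PU A B : measurable A -> measurable B -> A `&` B = set0 ->
    approximable A -> approximable B -> approximable (A `|` B).
  move=> mA mB AB PA PB e e0.
  have e4 : 0 < e / 4 by rewrite divr_gt0.
  have [p [p1 p2]] := PA _ e4; have [q [q1 q2]] := PB _ e4.
  exists (p + q); split.
    apply: (le_lt_trans (errU m1fin mu1 u1_01 p q mA mB AB)); lra.
  apply: (le_lt_trans (errU m2fin mu2 u2_01 p q mA mB AB)); lra.
have mE : @measurable _ (measurableTypeR R) = <<s @RGenOInfty.G R >>.
  exact: RGenOInfty.measurableE.
suff : forall S, <<s @RGenOInfty.G R >> S -> approximable S.
  by apply; rewrite -mE.
move=> {G mG}; apply: (@dynkin_induction _ (measurableTypeR R)).
- exact: mE.
- move=> _ _ [x ->] [y ->]; exists (Order.max x y).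
  apply/seteqP; split => z; rewrite /= !in_itv /= !andbT gt_max.
    by move=> [-> ->].
  by move=> /andP.
- by move=> e e0; exists 1; rewrite !errT.
- move=> _ [t ->] e e0.
  pose p n : {poly R} :=
    let q := sign_poly ((1 + `|t|)^-1 *: ('X - t%:P)) n in 2^-1 *: (q ^+ 2 + q).
  have -> : `]t, +oo[%classic = [set y | t < y].
    by apply/seteqP; split => y; rewrite /= in_itv /= andbT.
  near \oo => n; exists (p n); split.
    near: n; have /cvgrPdist_lt/(_ _ e0) := err_halfline m1fin mu1 u1_01 t.
    apply: filterS => n; rewrite sub0r normrN; exact: le_lt_trans (ler_norm _).
  near: n; have /cvgrPdist_lt/(_ _ e0) := err_halfline m2fin mu2 u2_01 t.
  apply: filterS => n; rewrite sub0r normrN; exact: le_lt_trans (ler_norm _).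
- move=> S mS PS e e0; have [p [p1 p2]] := PS _ e0.
  by exists (1 - p); rewrite !errC.
- move=> F mF tF PF e e0.
  have e4 : 0 < e / 4 by rewrite divr_gt0.
  have mU : measurable (\bigcup_k F k) by exact: bigcup_measurable.
  have mUn n : measurable (\big[setU/set0]_(k < n) F k) by exact: bigsetU_measurable.
  have PUn n : approximable (\big[setU/set0]_(k < n) F k).
    elim: n => [|n IH].
      move=> e' e'0; exists 0; rewrite big_ord0.
      by rewrite -setCT -[0](subrr 1) !errC !errT.
    rewrite big_ord_recr /=; apply: (PU _ _ (mUn n) (mF n) _ IH (PF n)).
    rewrite -subset0 -bigcup_mkord => z [[k /= kn Fk] Fn].
    have kn' : k != n by rewrite neq_ltn kn.
    move/trivIsetP : tF => /(_ k n Logic.I Logic.I kn').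
    by rewrite -subset0 => /(_ z); apply.
  near \oo => n.
  have [p [p1 p2]] := PUn n _ e4.
  exists p; split.
    apply: (le_lt_trans (err_tri m1fin mu1 u1_01 p (mUn n) mU)).
    suff : \int[m1]_x (\1_(\big[setU/set0]_(k < n) F k) (u1 x) -
      \1_(\bigcup_k F k) (u1 x)) ^+ 2 < e / 4 by lra.
    near: n; have /cvgrPdist_lt/(_ _ e4) := cvg_indic_bigcup m1fin mu1 mF.
    by apply: filterS => n; rewrite sub0r normrN; exact: le_lt_trans (ler_norm _).
  apply: (le_lt_trans (err_tri m2fin mu2 u2_01 p (mUn n) mU)).
  suff : \int[m2]_x (\1_(\big[setU/set0]_(k < n) F k) (u2 x) -
    \1_(\bigcup_k F k) (u2 x)) ^+ 2 < e / 4 by lra.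
  near: n; have /cvgrPdist_lt/(_ _ e4) := cvg_indic_bigcup m2fin mu2 mF.
  by apply: filterS => n; rewrite sub0r normrN; exact: le_lt_trans (ler_norm _).
Unshelve. all: by end_near. Qed.

End polynomial_approximation.

(** * The averaging operator of an automorphism *)

Section averaging_operator.
Context (R : realType) d (X : measurableType d) (mu : probability X R).
Context (T : automorphism mu).
Implicit Types (f g : X -> R) (p q : {poly R}).

Let mu_fin : (mu setT < +oo)%E.
Proof. by rewrite probability_setT ltry. Qed.

Definition ip f g := \int[mu]_x (f x * g x).

(** The operator (2 + U + U^-1) / 4 = ((1 + U) / 2)^* ((1 + U) / 2), where
    U f = f \o T.  It is self-adjoint with spectrum in [0, 1]: in the spectral
    representation on the circle it is multiplication by (1 + Re z) / 2. *)
Definition average f x := (2 * f x + f (T x) + f (aut_inv T x)) / 4.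

Definition average_poly (p : {poly R}) f x :=
  \sum_(i < size p) p`_i * iter i average f x.

Lemma bm_aut f : bounded_measurable f -> bounded_measurable (fun x => f (T x)).
Proof. by move=> bf; exact: (bm_comp (measurable_aut_fun T) bf). Qed.

Lemma bm_aut_inv f :
  bounded_measurable f -> bounded_measurable (fun x => f (aut_inv T x)).
Proof. by move=> bf; exact: (bm_comp (measurable_aut_inv T) bf). Qed.

Lemma bm_average f : bounded_measurable f -> bounded_measurable (average f).
Proof.
move=> bf; apply: bmM; last exact: bm_cst.
apply: bmD; last exact: bm_aut_inv.
by apply: bmD; [apply: bmM => //; exact: bm_cst|exact: bm_aut].
Qed.

Lemma bm_iter_average f i :
  bounded_measurable f -> bounded_measurable (iter i average f).
Proof. by move=> bf; elim: i => //= i; exact: bm_average. Qed.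

Lemma bm_average_poly p f :
  bounded_measurable f -> bounded_measurable (average_poly p f).
Proof.
move=> bf; apply: bm_sum => i.
by apply: bmM; [exact: bm_cst|exact: bm_iter_average].
Qed.

Lemma ipC f g : ip f g = ip g f.
Proof. by apply: eq_Rintegral => x _; rewrite mulrC. Qed.

Lemma ipDl f1 f2 g : bounded_measurable f1 -> bounded_measurable f2 ->
  bounded_measurable g -> ip (fun x => f1 x + f2 x) g = ip f1 g + ip f2 g.
Proof.
move=> b1 b2 bg; rewrite /ip -bm_RintegralD//; [|exact: bmM|exact: bmM].
by apply: eq_Rintegral => x _; rewrite mulrDl.
Qed.

Lemma ipZl c f g : bounded_measurable f -> bounded_measurable g ->
  ip (fun x => c * f x) g = c * ip f g.
Proof.
move=> bf bg; rewrite /ip -bm_RintegralZ//; last exact: bmM.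
by apply: eq_Rintegral => x _; rewrite mulrA.
Qed.

Lemma ip_ge0 f : 0 <= ip f f.
Proof. by apply: Rintegral_ge0 => x _; rewrite -expr2 sqr_ge0. Qed.

Lemma Rintegral_aut f : bounded_measurable f ->
  \int[mu]_x f (T x) = \int[mu]_x f x.
Proof.
move=> bf; symmetry; apply: bm_Rintegral_image => //.
  exact: measurable_aut_fun.
by move=> A mA; exact/esym/(aut_preserving T mA).
Qed.

Lemma ip_aut_inv f g : bounded_measurable f -> bounded_measurable g ->
  ip (fun x => f (aut_inv T x)) g = ip f (fun x => g (T x)).
Proof.
move=> bf bg; rewrite /ip -Rintegral_aut.
  by apply: eq_Rintegral => x _; rewrite aut_funK.
by apply: bmM => //; exact: bm_aut_inv.
Qed.

Lemma ip_aut f g : bounded_measurable f -> bounded_measurable g ->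
  ip (fun x => f (T x)) (fun x => g (T x)) = ip f g.
Proof.
by move=> bf bg; rewrite /ip (@Rintegral_aut (fun x => f x * g x))//; exact: bmM.
Qed.

Lemma ip_average f g : bounded_measurable f -> bounded_measurable g ->
  ip (average f) g =
  (2 * ip f g + ip (fun x => f (T x)) g + ip f (fun x => g (T x))) / 4.
Proof.
move=> bf bg; have bT := bm_aut bf; have bI := bm_aut_inv bf.
have b2 : bounded_measurable (fun x => 2 * f x) by apply: bmM => //; exact: bm_cst.
rewrite -ip_aut_inv// -ipZl// -ipDl// -ipDl//; last exact: bmD.
rewrite mulrC -ipZl//; last by apply: bmD => //; exact: bmD.
by congr ip; apply/funext => x; rewrite /average mulrC.
Qed.

Lemma ip_averageC f g : bounded_measurable f -> bounded_measurable g ->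
  ip (average f) g = ip f (average g).
Proof.
move=> bf bg; rewrite [RHS]ipC !ip_average// (ipC g f).
rewrite [ip (fun x => g (T x)) f]ipC [ip g _]ipC; ring.
Qed.

Lemma average_poly_widen p f n x : (size p <= n)%N ->
  average_poly p f x = \sum_(i < n) p`_i * iter i average f x.
Proof.
move=> pn; rewrite /average_poly (big_ord_widen _ (fun i => p`_i * iter i average f x) pn).
rewrite big_mkcond; apply: eq_bigr => i _; case: ltnP => // pi.
by rewrite nth_default// mul0r.
Qed.

Lemma average_polyD p q f :
  average_poly (p + q) f = (fun x => average_poly p f x + average_poly q f x).
Proof.
apply/funext => x; pose n := maxn (size p) (size q).
rewrite (@average_poly_widen (p + q) f n) ?size_polyD//.
rewrite (@average_poly_widen p f n) ?leq_maxl//.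
rewrite (@average_poly_widen q f n) ?leq_maxr//.
by rewrite -big_split; apply: eq_bigr => i _; rewrite coefD mulrDl.
Qed.

Lemma average_polyZ c p f :
  average_poly (c *: p) f = (fun x => c * average_poly p f x).
Proof.
apply/funext => x; rewrite (@average_poly_widen (c *: p) f (size p)) ?size_scale_leq//.
by rewrite mulr_sumr; apply: eq_bigr => i _; rewrite coefZ mulrA.
Qed.

Lemma average_polyC c f : average_poly c%:P f = (fun x => c * f x).
Proof.
apply/funext => x; rewrite (@average_poly_widen _ _ 1%N) ?size_polyC ?leq_b1//.
by rewrite big_ord1 coefC.
Qed.

Lemma average_poly1 f : average_poly 1 f = f.
Proof. by rewrite average_polyC; apply/funext => x; rewrite mul1r. Qed.

Lemma average_polyXM p f : average_poly ('X * p) f = average (average_poly p f).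
Proof.
apply/funext => x.
rewrite (@average_poly_widen ('X * p) f (size p).+1); last first.
  by rewrite mulrC (leq_trans (size_polyMleq _ _))// size_polyX addn2.
rewrite big_ord_recl /= coefXM eqxx mul0r add0r /average /average_poly.
rewrite mulr_sumr -!big_split mulr_suml; apply: eq_bigr => i _ /=.
by rewrite coefXM /= /average; field.
Qed.

Lemma average_polyM p q f :
  average_poly (p * q) f = average_poly p (average_poly q f).
Proof.
elim/poly_ind: p => [|p c IH].
  by rewrite mul0r -polyC0 !average_polyC; apply/funext => x; rewrite !mul0r.
rewrite mulrDl (mulrC p) -mulrA !average_polyD !average_polyXM IH.
by rewrite mul_polyC average_polyZ average_polyC.
Qed.

Lemma ip_average_poly p f g : bounded_measurable f -> bounded_measurable g ->
  ip (average_poly p f) g = ip f (average_poly p g).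
Proof.
move=> bf; elim/poly_ind: p g => [|p c IH] g bg.
  by rewrite -polyC0 !average_polyC ipZl// [RHS]ipC ipZl// !mul0r.
have bpf := bm_average_poly p bf; have bpg := bm_average_poly p bg.
have bcf := bmM (bm_cst X c) bf; have bcg := bmM (bm_cst X c) bg.
rewrite mulrC !average_polyD !average_polyXM !average_polyC.
rewrite ipDl//; last exact: bm_average.
rewrite [RHS]ipC ipDl//; last exact: bm_average.
rewrite !ipZl// (ipC g f); congr (_ + _).
rewrite ip_averageC// IH; last exact: bm_average.
rewrite ipC; congr ip.
have averageE h : average h = average_poly 'X h.
  by rewrite -[X in average_poly X]mulr1 average_polyXM average_poly1.
by rewrite !averageE -!average_polyM mulrC.
Qed.

End averaging_operator.

(** * Orthogonality from mutual singularity *)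

(** The Chebyshev polynomials in the variable 2X - 1: if X stands for
    (1 + cos t) / 2 then cheb n stands for cos (n t). *)
Fixpoint cheb (R : nzRingType) n : {poly R} :=
  match n with
  | 0 => 1
  | m.+1 => if m is k.+1 then 2 *: ((2 *: 'X - 1) * cheb R m) - cheb R k
            else 2 *: 'X - 1
  end.

Lemma cheb_ind (P : nat -> Prop) : P 0%N -> P 1%N ->
  (forall n, P n -> P n.+1 -> P n.+2) -> forall n, P n.
Proof.
move=> P0 P1 PS n; suff [] : P n /\ P n.+1 by [].
by elim: n => // n [IH IH1]; split => //; exact: PS.
Qed.

(** Multiplication by X maps each cheb n to a combination of cheb (n - 1),
    cheb n and cheb (n + 1), so agreement spreads from the cheb n to all the
    X^k * cheb n, and in particular to the X^k. *)
Lemma cheb_determine (R : numFieldType) (L1 L2 : {poly R} -> R) :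
  (forall c p q, L1 (c *: p + q) = c * L1 p + L1 q) ->
  (forall c p q, L2 (c *: p + q) = c * L2 p + L2 q) ->
  (forall n, L1 (cheb R n) = L2 (cheb R n)) -> forall p, L1 p = L2 p.
Proof.
move=> l1 l2 e.
have ext c p q : L1 p = L2 p -> L1 q = L2 q -> L1 (c *: p + q) = L2 (c *: p + q).
  by move=> ep eq; rewrite l1 l2 ep eq.
have e0 : L1 0 = L2 0.
  by rewrite -[0](subrr 1) -scaleN1r addrC; apply: ext; exact: (e 0%N).
have extZ c p : L1 p = L2 p -> L1 (c *: p) = L2 (c *: p).
  by move=> ep; rewrite -[_ *: _]addr0; exact: ext.
have Xcheb k n : L1 ('X^k * cheb R n) = L2 ('X^k * cheb R n).
  elim: k n => [|k IH] n; first by rewrite expr0 mul1r.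
  case: n => [|n].
    have -> : 'X^(k.+1) * cheb R 0 =
        2^-1 *: ('X^k * cheb R 1) + 2^-1 *: ('X^k * cheb R 0).
      rewrite -scalerDr -mulrDr /= subrK -scalerAr scalerA mulVf ?pnatr_eq0//.
      by rewrite scale1r mulr1 exprSr.
    by apply: (ext) => //; exact: extZ.
  have -> : 'X^(k.+1) * cheb R n.+1 = 4^-1 *: ('X^k * cheb R n.+2) +
      (4^-1 *: ('X^k * cheb R n) + 2^-1 *: ('X^k * cheb R n.+1)).
    apply: (@scalerI _ _ (4 : R)); first by rewrite pnatr_eq0.
    rewrite !scalerDr !scalerA mulfV ?pnatr_eq0// !scale1r.
    have -> : 4 / 2 = 2 :> R by field.
    rewrite [cheb R n.+2]/= -/(cheb R n.+1) !scaler_nat exprS.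
    set a := cheb R n.+1; set b := cheb R n; ring.
  by apply: (ext) => //; apply: (ext) => //; exact: extZ.
move=> p; rewrite -[p]coefK poly_def; elim/big_rec: _ => [|i q _ IH].
  exact: e0.
by apply: (ext) => //; have := Xcheb i 0%N; rewrite mulr1.
Qed.

Section orthogonality.
Context (R : realType) d (X : measurableType d) (mu : probability X R).
Context (T : automorphism mu).
Implicit Types (f g : X -> R) (p q : {poly R}).

Lemma bm_iter f n :
  bounded_measurable f -> bounded_measurable (fun x => f (iter n T x)).
Proof.
move=> bf; elim: n => // n IH; have := bm_aut T IH.
by under eq_fun do rewrite -iterSr.
Qed.

Lemma bm_iter_inv f n :
  bounded_measurable f -> bounded_measurable (fun x => f (iter n (aut_inv T) x)).
Proof.
move=> bf; elim: n => // n IH; have := bm_aut_inv T IH.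
by under eq_fun do rewrite -iterSr.
Qed.

(** The n-th Fourier coefficient of the spectral measure of f. *)
Definition autocorrelation f n := ip mu (fun x => f (iter n T x)) f.

(** As 4 W - 2 = U + U^-1, the recurrence for cheb is the one satisfied by
    (U^n + U^-n) / 2. *)
Lemma average_poly_cheb n f : average_poly T (cheb R n) f =
  (fun x => (f (iter n T x) + f (iter n (aut_inv T) x)) / 2).
Proof.
have step q : average_poly T (2 *: ((2 *: 'X - 1) * q)) f =
    (fun x => average_poly T q f (T x) + average_poly T q f (aut_inv T x)).
  have -> : 2 *: ((2 *: 'X - 1) * q) = 4 *: ('X * q) + (- 2) *: q.
    by rewrite scaleNr !scaler_nat; ring.
  rewrite average_polyD !average_polyZ average_polyXM; apply/funext => x.
  by rewrite /average; field.
elim/cheb_ind: n => [||n IH IH1].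
- by rewrite average_poly1; apply/funext => x /=; field.
- have -> : cheb R 1 = 2^-1 *: (2 *: ((2 *: 'X - 1) * 1)).
    by rewrite scalerA mulVf ?pnatr_eq0// scale1r mulr1.
  by rewrite average_polyZ step average_poly1; apply/funext => x /=; rewrite mulrC.
- rewrite [cheb R n.+2]/= -/(cheb R n.+1) -[- cheb R n]scaleN1r average_polyD.
  rewrite step average_polyZ IH IH1; apply/funext => x.
  rewrite -!iterSr [iter n.+1 (aut_inv T) (T x)]iterSr aut_funK.
  by rewrite [iter n.+1 T (aut_inv T x)]iterSr aut_invK; field.
Qed.

Lemma ip_iter_inv f g n : bounded_measurable f -> bounded_measurable g ->
  ip mu (fun x => f (iter n (aut_inv T) x)) g = ip mu f (fun x => g (iter n T x)).
Proof.
move=> bf bg; elim: n g bg => // n IH g bg.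
under [X in ip _ X _]eq_fun do rewrite iterSr.
rewrite (@ip_aut_inv _ _ _ _ T (fun x => f (iter n (aut_inv T) x)))//.
  by rewrite (IH (fun x => g (T x)))//; exact: bm_aut.
exact: bm_iter_inv.
Qed.

Lemma ip_cheb f n : bounded_measurable f ->
  ip mu (average_poly T (cheb R n) f) f = autocorrelation f n.
Proof.
move=> bf; have b1 := bm_iter n bf; have b2 := bm_iter_inv n bf.
rewrite average_poly_cheb.
under [X in ip _ X _]eq_fun do rewrite mulrC.
rewrite ipZl//; last exact: bmD.
by rewrite ipDl// ip_iter_inv// [ip _ f _]ipC /autocorrelation; field.
Qed.

Lemma ip_average_poly_lin f c p q : bounded_measurable f ->
  ip mu (average_poly T (c *: p + q) f) f =
  c * ip mu (average_poly T p f) f + ip mu (average_poly T q f) f.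
Proof.
move=> bf; rewrite average_polyD average_polyZ ipDl ?ipZl//.
- exact: bm_average_poly.
- by apply: bmM; [exact: bm_cst|exact: bm_average_poly].
- exact: bm_average_poly.
Qed.

Lemma ip_average_poly_sq f p : bounded_measurable f ->
  ip mu (average_poly T (p ^+ 2) f) f =
  ip mu (average_poly T p f) (average_poly T p f).
Proof.
by move=> bf; rewrite expr2 average_polyM ip_average_poly//; exact: bm_average_poly.
Qed.

(** The autocorrelations of f determine the form p |-> <p(W) f, f>. *)
Lemma spectral_representation f d' (Y : measurableType d')
    (m : {measure set Y -> \bar R}) (u : Y -> R) :
  bounded_measurable f -> (m setT < +oo)%E -> bounded_measurable u ->
  (forall n, \int[m]_y (cheb R n).[u y] = autocorrelation f n) ->
  forall p, \int[m]_y p.[u y] = ip mu (average_poly T p f) f.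
Proof.
move=> bf mfin bu h; apply: cheb_determine => [c p q|c p q|n].
- under eq_Rintegral do rewrite hornerD hornerZ.
  rewrite bm_RintegralD ?bm_RintegralZ//; try exact: bm_horner.
  by apply: bmM; [exact: bm_cst|exact: bm_horner].
- exact: ip_average_poly_lin.
- by rewrite h ip_cheb.
Qed.

(** The Cauchy-Schwarz inequality in the weighted form that needs no square
    root: both e f + g and e f - g have a nonnegative square. *)
Lemma ip_le f g e : bounded_measurable f -> bounded_measurable g -> 0 < e ->
  2 * e * `|ip mu f g| <= e ^+ 2 * ip mu f f + ip mu g g.
Proof.
move=> bf bg e0.
have bef : bounded_measurable (fun x => e * f x) by apply: bmM => //; exact: bm_cst.
have expand s : bounded_measurable (fun x => s * g x) ->
   ip mu (fun x => e * f x + s * g x) (fun x => e * f x + s * g x) =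
   e ^+ 2 * ip mu f f + s ^+ 2 * ip mu g g + 2 * e * s * ip mu f g.
  move=> bs; have b := bmD bef bs.
  rewrite ipDl// !ipZl// [ip mu f _]ipC [ip mu g _]ipC !ipDl// !ipZl//.
  rewrite (ipC _ g f); ring.
have h s : 0 <= e ^+ 2 * ip mu f f + s ^+ 2 * ip mu g g + 2 * e * s * ip mu f g.
  rewrite -expand; first exact: ip_ge0.
  by apply: bmM => //; exact: bm_cst.
have := h 1; have := h (-1); rewrite sqrrN expr1n.
by case: (ler0P (ip mu f g)) => _; lra.
Qed.

(** Choose p close to the indicator of G in L^2 of both spectral measures, one
    being carried by the complement of G and the other by G.  Then p(W) f and
    (1 - p)(W) g are small, and
    <f, g> = <f, (1 - p)(W) g> + <p(W) f, g>
    because W is self-adjoint. *)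
Lemma singular_orthogonal f g d1 d2 (Y1 : measurableType d1)
    (Y2 : measurableType d2) (m1 : {measure set Y1 -> \bar R})
    (m2 : {measure set Y2 -> \bar R}) (u1 : Y1 -> R) (u2 : Y2 -> R) (G : set R) :
  bounded_measurable f -> bounded_measurable g ->
  (m1 setT < +oo)%E -> (m2 setT < +oo)%E ->
  measurable_fun setT u1 -> measurable_fun setT u2 ->
  (forall y, 0 <= u1 y <= 1) -> (forall y, 0 <= u2 y <= 1) ->
  (forall n, \int[m1]_y (cheb R n).[u1 y] = autocorrelation f n) ->
  (forall n, \int[m2]_y (cheb R n).[u2 y] = autocorrelation g n) ->
  measurable G -> m1 (u1 @^-1` G) = 0%E -> m2 (u2 @^-1` ~` G) = 0%E ->
  ip mu f g = 0.
Proof.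
move=> bf bg m1fin m2fin mu1 mu2 u1_01 u2_01 h1 h2 mG G1 G2.
have bu1 : bounded_measurable u1.
  by split=> //; exists 1 => x; have /andP[? ?] := u1_01 x; rewrite ger0_norm.
have bu2 : bounded_measurable u2.
  by split=> //; exists 1 => x; have /andP[? ?] := u2_01 x; rewrite ger0_norm.
have r1 := spectral_representation bf m1fin bu1 h1.
have r2 := spectral_representation bg m2fin bu2 h2.
(* Used with q = p and E = G, then with q = 1 - p and E the complement of G: up
   to sign, q is p - 1_G off the null set E. *)
have key d0 (Y : measurableType d0) (m : {measure set Y -> \bar R}) (u : Y -> R)
    (E : set R) p q e :
  (m setT < +oo)%E -> bounded_measurable u -> measurable E ->
  m (u @^-1` E) = 0%E ->
  (forall y, q.[u y] ^+ 2 <= 2 * (p.[u y] - \1_G (u y)) ^+ 2 + 2 * \1_E (u y)) ->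
  \int[m]_y (p.[u y] - \1_G (u y)) ^+ 2 < e ->
  \int[m]_y (q ^+ 2).[u y] <= 2 * e.
  move=> mfin bu mE E0 qp pe.
  have mu_ : measurable_fun setT u by case: bu.
  have bE := bm_comp mu_ (bm_indic R mE).
  have bG := bm_comp mu_ (bm_indic R mG).
  have bp : bounded_measurable (fun y => (p.[u y] - \1_G (u y)) ^+ 2).
    by apply: bmX; apply: bmB => //; exact: bm_horner.
  have b2p := bmM (bm_cst Y (2 : R)) bp; have b2E := bmM (bm_cst Y (2 : R)) bE.
  apply: (@le_trans _ _ (2 * \int[m]_y (p.[u y] - \1_G (u y)) ^+ 2)); last by lra.
  have <- : \int[m]_y (2 * (p.[u y] - \1_G (u y)) ^+ 2 + 2 * \1_E (u y)) =
      2 * \int[m]_y (p.[u y] - \1_G (u y)) ^+ 2.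
    rewrite bm_RintegralD// !bm_RintegralZ//.
    have -> : \int[m]_y \1_E (u y) = fine (m (u @^-1` E)).
      rewrite -bm_Rintegral_indic//; last first.
        by rewrite -[X in measurable X]setTI; exact: mu_.
    by rewrite E0 /= mulr0 addr0.
  apply: le_bm_Rintegral => //; first exact: bm_horner.
    exact: bmD.
  by move=> y; rewrite hornerE; exact: qp.
suff small e : 0 < e -> 2 * `|ip mu f g| <= e * (ip mu f f + ip mu g g + 4).
  apply/eqP; rewrite -normr_eq0 eq_le normr_ge0 andbT; apply/ler_addgt0Pl => e e0.
  rewrite addr0; pose C := ip mu f f + ip mu g g + 4.
  have C0 : 0 < C by rewrite ltr_wpDl// addr_ge0 ?ip_ge0.
  have := small (e / C) (divr_gt0 e0 C0); rewrite -/C divfK ?gt_eqF//.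
  have := normr_ge0 (ip mu f g); lra.
move=> e0; have e20 : 0 < e ^+ 2 by rewrite exprn_gt0.
have [p [p1 p2]] := polynomial_approximation m1fin m2fin mu1 mu2 u1_01 u2_01 mG e20.
have k1 : ip mu (average_poly T p f) (average_poly T p f) <= 2 * e ^+ 2.
  rewrite -ip_average_poly_sq// -r1; apply: (key _ _ _ _ G p) => // y.
  set a := p.[_]; set b : R := \1_G _.
  have b2 : b ^+ 2 = b.
    by rewrite /b indicE; case: (_ \in _); rewrite ?expr1n ?expr0n.
  have := sqr_ge0 (a - 2 * b); lra.
have k2 : ip mu (average_poly T (1 - p) g) (average_poly T (1 - p) g) <= 2 * e ^+ 2.
  rewrite -ip_average_poly_sq// -r2; apply: (key _ _ _ _ (~` G) p) => // [|y].
    exact: measurableC.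
  rewrite !hornerE; set a := p.[_].
  rewrite !indicE in_setC; case: (_ \in _) => /=.
    by have := sqr_ge0 (a - 1); lra.
  have := sqr_ge0 (a + 1); lra.
have bpf := bm_average_poly T p bf; have bpg := bm_average_poly T (1 - p) bg.
have -> : ip mu f g = ip mu f (average_poly T (1 - p) g) +
    ip mu g (average_poly T p f).
  rewrite [ip mu g _]ipC ip_average_poly// [RHS]addrC ![ip mu f _]ipC -ipDl//; last first.
    exact: bm_average_poly.
  by rewrite -average_polyD addrC subrK average_poly1.
have i1 := ip_le bf bpg e0; have i2 := ip_le bg bpf e0.
have := ler_normD (ip mu f (average_poly T (1 - p) g)) (ip mu g (average_poly T p f)).
set A := `|_ + _|; set B := `|_|; set C := `|_| => ABC.
rewrite -(ler_pM2l e0).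
have : e * (2 * A) <= 2 * e * (B + C).
  by rewrite mulrA [e * 2]mulrC ler_pM2l// mulr_gt0.
rewrite -/B in i1; rewrite -/C in i2.
lra.
Qed.

End orthogonality.

(** * The circle and its heights *)

Section circle_facts.
Context (R : realType).
Local Notation Re := complex.Re.
Local Notation Im := complex.Im.
Implicit Types z w : circle R.

Lemma Re_mul (x y : R[i]) : Re (x * y) = Re x * Re y - Im x * Im y.
Proof. by case: x => a b; case: y. Qed.

Lemma Im_mul (x y : R[i]) : Im (x * y) = Re x * Im y + Im x * Re y.
Proof. by case: x => a b; case: y. Qed.

Lemma circle_exp_norm z n : Re (circle_val z ^+ n) ^+ 2 + Im (circle_val z ^+ n) ^+ 2 = 1.
Proof.
have : `|circle_val z ^+ n| ^+ 2 = 1 by rewrite normrX (eqP (valP z)) !expr1n.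
by rewrite -add_Re2_Im2 => /(congr1 (@complex.Re R)).
Qed.

Lemma circle_norm z : Re (circle_val z) ^+ 2 + Im (circle_val z) ^+ 2 = 1.
Proof. exact: (circle_exp_norm z 1). Qed.

Lemma circle_normP (x : R[i]) : Re x ^+ 2 + Im x ^+ 2 = 1 -> `|x| == 1.
Proof. by move=> h; rewrite normc_def h sqrtr1. Qed.

Definition mk_circle (x : R[i]) (h : Re x ^+ 2 + Im x ^+ 2 = 1) : circle R :=
  exist _ x (circle_normP h).

Lemma circle_eq z w : Re (circle_val z) = Re (circle_val w) ->
  Im (circle_val z) = Im (circle_val w) -> z = w.
Proof.
by move=> re im; apply: val_inj; apply/eqP; rewrite eq_complex re im !eqxx.
Qed.

Lemma circle_conj_norm z : Re ((circle_val z)^*)%C ^+ 2 + Im ((circle_val z)^*)%C ^+ 2 = 1.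
Proof. by rewrite -[RHS](circle_norm z); case: (circle_val z) => a b /=; rewrite sqrrN. Qed.

Definition circle_conj z : circle R := mk_circle (circle_conj_norm z).

Lemma Re_circle_conj z : Re (circle_val (circle_conj z)) = Re (circle_val z).
Proof. by rewrite {1}/circle_val /=; case: (circle_val z). Qed.

Lemma Im_circle_conj z : Im (circle_val (circle_conj z)) = - Im (circle_val z).
Proof. by rewrite {1}/circle_val /=; case: (circle_val z). Qed.

Lemma circle_conj_exp z n :
  circle_val (circle_conj z) ^+ n = ((circle_val z ^+ n)^*)%C.
Proof. by rewrite /= rmorphXn. Qed.

Lemma circle_exprN z n : circle_val z ^- n = ((circle_val z ^+ n)^*)%C.
Proof.
rewrite invc_norm normrX (eqP (valP z)) !expr1n invr1 mul1r.
by [].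
Qed.

Lemma measurable_circle_Re : measurable_fun setT (fun z => Re (circle_val z)).
Proof.
have mcoord : measurable_fun setT (@circle_coord R) by move=> _ B mB; exists B.
exact: (measurableT_comp measurable_fst mcoord).
Qed.

Lemma measurable_circle_Im : measurable_fun setT (fun z => Im (circle_val z)).
Proof.
have mcoord : measurable_fun setT (@circle_coord R) by move=> _ B mB; exists B.
exact: (measurableT_comp measurable_snd mcoord).
Qed.

Lemma measurable_to_circle d (X : measurableType d) (h : X -> circle R) :
  measurable_fun setT (fun x => Re (circle_val (h x))) ->
  measurable_fun setT (fun x => Im (circle_val (h x))) ->
  measurable_fun setT h.
Proof.
move=> mre mim _ _ [B mB <-]; rewrite !setTI.
have mc : measurable_fun setT (fun x => circle_coord (h x)).
  exact/measurable_fun_pairP.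
by rewrite -[X in measurable X]setTI; exact: (mc measurableT B mB).
Qed.

Lemma measurable_circle_conj : measurable_fun setT circle_conj.
Proof.
apply: measurable_to_circle.
  have -> : (fun z => Re (circle_val (circle_conj z))) = fun z => Re (circle_val z).
    by apply/funext => z; exact: Re_circle_conj.
  exact: measurable_circle_Re.
have -> : (fun z => Im (circle_val (circle_conj z))) = fun z => - Im (circle_val z).
  by apply/funext => z; exact: Im_circle_conj.
exact: (measurable_funN measurable_circle_Im).
Qed.

Lemma circle_conjK z : circle_conj (circle_conj z) = z.
Proof. by apply: circle_eq; rewrite ?Re_circle_conj// !Im_circle_conj opprK. Qed.

Let sqr_le1 (a b : R) : a ^+ 2 + b ^+ 2 = 1 -> `|a| <= 1.
Proof.
move=> h; rewrite -[leRHS]sqrtr1 -h -sqrtr_sqr ler_wsqrtr// lerDl; exact: sqr_ge0.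
Qed.

Lemma bm_circle_exp n : bounded_measurable (fun z => Re (circle_val z ^+ n)) /\
  bounded_measurable (fun z => Im (circle_val z ^+ n)).
Proof.
suff [mre mim] : measurable_fun setT (fun z => Re (circle_val z ^+ n)) /\
    measurable_fun setT (fun z => Im (circle_val z ^+ n)).
  split; split => //; exists 1 => z; have h := circle_exp_norm z n.
    exact: sqr_le1 h.
  by apply: sqr_le1; rewrite addrC; exact: h.
elim: n => [|n [mre mim]]; first by split; exact: measurable_cst.
split.
  under eq_fun do rewrite exprS Re_mul.
  apply: measurable_funB; apply: measurable_funM => //.
    exact: measurable_circle_Re.
  exact: measurable_circle_Im.
under eq_fun do rewrite exprS Im_mul.
apply: measurable_funD; apply: measurable_funM => //.
  exact: measurable_circle_Re.
exact: measurable_circle_Im.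
Qed.

(** The affine image in [0, 1] of the real part: the symbol of the averaging
    operator. *)
Definition circle_height z : R := (1 + Re (circle_val z)) / 2.

Lemma circle_height_itv z : 0 <= circle_height z <= 1.
Proof.
have := sqr_le1 (circle_norm z); rewrite ler_norml /circle_height => /andP[? ?].
by apply/andP; split; lra.
Qed.

Lemma measurable_circle_height : measurable_fun setT circle_height.
Proof.
apply: measurable_funM; last exact: measurable_cst.
by apply: measurable_funD => //; exact: measurable_circle_Re.
Qed.

(** z^(n + 2) = 2 (Re z) z^(n + 1) - z^n on the unit circle. *)
Lemma cheb_circle_height n z :
  (cheb R n).[circle_height z] = Re (circle_val z ^+ n).
Proof.
elim/cheb_ind: n => [||n IH IH1].
- by rewrite hornerC.
- by rewrite [cheb R 1]/= expr1 hornerD hornerN hornerZ hornerX hornerC /circle_height; field.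
- rewrite [cheb R n.+2]/= -/(cheb R n.+1) hornerD hornerN hornerZ hornerM IH IH1.
  rewrite hornerD hornerN hornerZ hornerX hornerC /circle_height.
  rewrite [circle_val z ^+ n.+2]exprS Re_mul exprS Im_mul Re_mul.
  have := circle_norm z; set a := Re _; set b := Im _; set c := Re _; set e := Im _.
  move=> h; apply/eqP; rewrite -subr_eq0; apply/eqP.
  transitivity (c * (a ^+ 2 + b ^+ 2 - 1)); first by field.
  by rewrite h subrr mulr0.
Qed.

(** A section of the height: the point of height u on the upper half circle,
    where u is first clipped to [0, 1]. *)
Definition arc_Re (u : R) : R := Num.max (- 1) (Num.min 1 (2 * u - 1)).

Lemma arc_norm u : Re (arc_Re u +i* Num.sqrt (1 - arc_Re u ^+ 2))%C ^+ 2 +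
  Im (arc_Re u +i* Num.sqrt (1 - arc_Re u ^+ 2))%C ^+ 2 = 1.
Proof.
have /andP[h1 h2] : -1 <= arc_Re u <= 1.
  by rewrite /arc_Re le_max lexx ge_max ge_min lexx/= andbT; lra.
have h : 0 <= 1 - arc_Re u ^+ 2.
  have : 0 <= (1 - arc_Re u) * (1 + arc_Re u) by rewrite mulr_ge0; lra.
  lra.
by move: h; rewrite /=; set a := arc_Re u => h; rewrite (sqr_sqrtr h) addrC subrK.
Qed.

Definition arc u : circle R := mk_circle (arc_norm u).

Lemma measurable_arc : measurable_fun setT arc.
Proof.
have mre : measurable_fun setT arc_Re.
  apply: measurable_maxr => //; apply: measurable_minr => //.
  by apply: measurable_funB => //; apply: measurable_funM.
apply: measurable_to_circle => //=.
have msqrt : measurable_fun setT (@Num.sqrt R).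
  by apply: nondecreasing_measurable => // x y; exact: ler_wsqrtr.
apply: (measurableT_comp msqrt).
by apply: measurable_funB => //; exact: measurable_funX.
Qed.

Lemma arc_circle_height z : arc (circle_height z) = z \/
  arc (circle_height z) = circle_conj z.
Proof.
have := sqr_le1 (circle_norm z); rewrite ler_norml => /andP[h1 h2].
have re : arc_Re (circle_height z) = Re (circle_val z).
  rewrite /arc_Re /circle_height mulrCA divff ?pnatr_eq0// mulr1 [1 + _]addrC addrK.
  by rewrite (min_idPr h2) (max_idPr h1).
have im : Num.sqrt (1 - Re (circle_val z) ^+ 2) = `|Im (circle_val z)|.
  by rewrite -(circle_norm z) addrAC subrr add0r sqrtr_sqr.
have [b0|b0] := leP 0 (Im (circle_val z)); [left|right].
  by apply: circle_eq; rewrite /circle_val /= re// im ger0_norm.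
apply: circle_eq; first by rewrite Re_circle_conj /circle_val /= re.
by rewrite Im_circle_conj {1}/circle_val /= re im ltr0_norm.
Qed.

Lemma circle_height_arc u : 0 <= u <= 1 -> circle_height (arc u) = u.
Proof.
move=> /andP[u0 u1]; rewrite /circle_height /circle_val /= /arc_Re.
have h2 : 2 * u - 1 <= 1 by lra.
have h1 : - 1 <= 2 * u - 1 by lra.
by rewrite (min_idPr h2) (max_idPr h1); field.
Qed.

Lemma circle_height_conj z : circle_height (circle_conj z) = circle_height z.
Proof. by rewrite /circle_height Re_circle_conj. Qed.

End circle_facts.

(** * Spectral measures of real functions *)

Lemma image_measure (R : realType) d d' (X : measurableType d)
    (Y : measurableType d') (m : {measure set X -> \bar R}) (phi : X -> Y) :
  measurable_fun setT phi ->
  exists m' : {measure set Y -> \bar R}, forall A, m' A = m (phi @^-1` A).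
Proof.
by move=> mphi; unshelve eexists (pushforward m phi : {measure set Y -> \bar R}).
Qed.

Lemma finite_measure_add (R : realType) d (X : measurableType d)
    (m1 m2 : {measure set X -> \bar R}) :
  (m1 setT < +oo)%E -> (m2 setT < +oo)%E ->
  exists2 m : {finite_measure set X -> \bar R},
    forall A, m A = (m1 A + m2 A)%E &
    forall f, bounded_measurable f ->
      \int[m]_x f x = \int[m1]_x f x + \int[m2]_x f x.
Proof.
move=> fin1 fin2.
pose s : {measure set X -> \bar R} := msum (fun n => if n is 0%N then m1 else m2) 2.
have fin : fin_num_fun s.
  apply: lty_fin_num_fun.
  by rewrite -[X in (X < _)%E]/(measure_add m1 m2 setT) measure_addE lte_add_pinfty.
pose m : {finite_measure set X -> \bar R} :=
  HB.pack (s : set X -> \bar R) s (Measure_isFinite.Build _ _ _ s fin).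
exists m => [A|f bf]; first exact: measure_addE.
rewrite /Rintegral integral_measure_add//; [|exact: bm_integrable..].
by rewrite fineD//; apply: integrable_fin_num => //; exact: bm_integrable.
Qed.

Section herglotz.
Context (R : realType) d (X : measurableType d) (mu : probability X R).
Context (T : automorphism mu).
Local Notation Re := complex.Re.
Local Notation Im := complex.Im.

Let ip_1U (s : R) (g : X -> R) : s ^+ 2 = 1 -> bounded_measurable g ->
  ip mu (fun x => g x + s * g (T x)) (fun x => g x + s * g (T x)) =
  2 * ip mu g g + 2 * s * ip mu (fun x => g (T x)) g.
Proof.
move=> s1 bg; have bT := bm_aut T bg.
have bs : bounded_measurable (fun x => s * g (T x)) by apply: bmM => //; exact: bm_cst.
have b := bmD bg bs.
rewrite ipDl// ipZl// ![ip mu _ (fun x => g x + _)]ipC !ipDl// !ipZl// ip_aut//.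
rewrite [ip mu g (fun x => g (T x))]ipC mulrDr mulrA -expr2 s1; ring.
Qed.

(** Positivity of W = (1 + U)^* (1 + U) / 4 and of
    1 - W = (1 - U)^* (1 - U) / 4 gives the positivity required of a moment
    functional on [0, 1]. *)
Lemma average_poly_moment (f : X -> R) : bounded_measurable f ->
  exists (m0 : {finite_measure set (measurableTypeR R) -> \bar R}) (q : R -> R),
  [/\ measurable_fun setT q, forall x, 0 <= q x <= 1 &
      forall p, \int[m0]_x p.[q x] = 2^-1 * ip mu (average_poly T p f) f].
Proof.
move=> bf; apply: hausdorff_moment => [c p q|p|p|p].
- by rewrite ip_average_poly_lin//; ring.
- by rewrite ip_average_poly_sq// mulr_ge0 ?invr_ge0// ip_ge0.
- have bg := bm_average_poly T p bf; have bT := bm_aut T bg.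
  have -> : 'X * p ^+ 2 = p * ('X * p) by ring.
  rewrite average_polyM ip_average_poly ?average_polyXM//; last exact: bm_average.
  rewrite ip_average// [ip _ _ (fun x => _ (T x))]ipC.
  have := ip_1U (expr1n _ 2) bg; have := ip_ge0 mu (fun x =>
    average_poly T p f x + 1 * average_poly T p f (T x)); lra.
- have bg := bm_average_poly T p bf; have bT := bm_aut T bg.
  have -> : (1 - 'X) * p ^+ 2 = (- 1) *: (p * ('X * p)) + p ^+ 2.
    by rewrite scaleN1r; ring.
  rewrite ip_average_poly_lin// ip_average_poly_sq//.
  rewrite average_polyM ip_average_poly ?average_polyXM//; last exact: bm_average.
  rewrite ip_average// [ip _ _ (fun x => _ (T x))]ipC.
  have sN : (-1 : R) ^+ 2 = 1 by rewrite sqrrN expr1n.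
  have := ip_1U sN bg; have := ip_ge0 mu (fun x =>
    average_poly T p f x + (- 1) * average_poly T p f (T x)); lra.
Qed.

(** The solution of the moment problem is a measure on heights.  Lifting half of
    it to each of the two half circles gives a measure invariant under
    conjugation, whose sine coefficients therefore vanish and whose cosine
    coefficients are moments of Chebyshev polynomials. *)
Lemma herglotz (f : X -> R) : bounded_measurable f ->
  exists sigma : {finite_measure set (circle R) -> \bar R},
  [/\ forall n, \int[sigma]_z Re (circle_val z ^+ n) = autocorrelation T f n,
      forall n, \int[sigma]_z Im (circle_val z ^+ n) = 0 &
      forall A, measurable A -> sigma (@circle_conj R @^-1` A) = sigma A].
Proof.
move=> bf; have [m0 [q [mq q01 m0q]]] := average_poly_moment bf.
have m0fin : (m0 setT < +oo)%E by exact: fin_num_fun_lty.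
pose g1 x := arc (q x); pose g2 x := circle_conj (g1 x).
have mg1 : measurable_fun setT g1.
  exact: (measurableT_comp (@measurable_arc R) mq).
have mg2 : measurable_fun setT g2.
  exact: (measurableT_comp (@measurable_circle_conj R) mg1).
have [p1 p1E] := image_measure m0 mg1; have [p2 p2E] := image_measure m0 mg2.
have [||sigma sigmaE sigma_int] := @finite_measure_add _ _ _ p1 p2.
- by rewrite p1E preimage_setT.
- by rewrite p2E preimage_setT.
have intE h : bounded_measurable h ->
    \int[sigma]_z h z = \int[m0]_x h (g1 x) + \int[m0]_x h (g2 x).
  move=> bh; rewrite sigma_int//; congr (_ + _).
    by apply: bm_Rintegral_image => // A _; exact: p1E.
  by apply: bm_Rintegral_image => // A _; exact: p2E.
exists sigma; split=> [n|n|A mA].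
- have [bre _] := bm_circle_exp R n.
  rewrite intE//.
  under eq_Rintegral do rewrite -cheb_circle_height circle_height_arc//.
  under [X in _ + X]eq_Rintegral do
    rewrite -cheb_circle_height circle_height_conj circle_height_arc//.
  by rewrite m0q -ip_cheb//; field.
- have [_ bim] := bm_circle_exp R n.
  rewrite intE// -bm_RintegralD//; [|exact: (bm_comp mg1 bim)|exact: (bm_comp mg2 bim)].
  under eq_Rintegral => x _.
    rewrite circle_conj_exp (_ : _ + _ = 0); first over.
    by case: (_ ^+ n) => a b /=; rewrite subrr.
  by rewrite Rintegral_cst// mul0r.
- rewrite !sigmaE !p1E !p2E addeC; congr (_ + _)%E.
  congr (m0 _); apply/seteqP; split => x; rewrite /= /g2 circle_conjK//.
Qed.

End herglotz.

Section wiener.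
Context (R : realType).
Local Notation Re := complex.Re.
Local Notation Im := complex.Im.

Lemma measurable_circle_set1 (w : circle R) : measurable [set w].
Proof.
have -> : [set w] = [set z : circle R | Re (circle_val z) = Re (circle_val w)] `&`
    [set z | Im (circle_val z) = Im (circle_val w)].
  by apply/seteqP; split => [_ ->//|z [re im]]; exact: circle_eq.
apply: measurableI; rewrite -[X in measurable X]setTI.
  exact: (@measurable_circle_Re R measurableT _ (measurable_set1 (Re (circle_val w)))).
exact: (@measurable_circle_Im R measurableT _ (measurable_set1 (Im (circle_val w)))).
Qed.

(** The mean over k < N of Re (z / w)^k, which tends boundedly to the indicator
    of w, by summing a geometric series. *)
Let mean (w : circle R) (N : nat) (z : circle R) : R := N%:R^-1 *
  \sum_(k < N) (Re (circle_val z ^+ k) * Re (circle_val w ^+ k) +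
                Im (circle_val z ^+ k) * Im (circle_val w ^+ k)).

Let meanE w N z : mean w N z =
  N%:R^-1 * Re (\sum_(k < N) (circle_val z * ((circle_val w)^*)%C) ^+ k).
Proof.
rewrite /mean; congr (_ * _).
rewrite (big_morph (@complex.Re R) (op1 := +%R) (id1 := 0)) //; last first.
  by case=> a b [].
apply: eq_bigr => k _; rewrite exprMn Re_mul -rmorphXn.
by case: (circle_val z ^+ k) => a b; case: (circle_val w ^+ k) => c e /=; ring.
Qed.

Let mean_diag w N : mean w N.+1 w = 1.
Proof.
rewrite /mean (eq_bigr (fun=> 1)); last first.
  by move=> k _; rewrite -!expr2 circle_exp_norm.
by rewrite sumr_const card_ord mulVf.
Qed.

Let mean_bound w N z : `|mean w N z| <= 1.
Proof.
rewrite /mean normrM ger0_norm ?invr_ge0//.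
case: N => [|N]; first by rewrite big_ord0 normr0 mulr0.
rewrite ler_pdivrMl// mulr1 (le_trans (ler_norm_sum _ _ _))//.
rewrite -[leRHS](_ : \sum_(k < N.+1) (1 : R) = _); last by rewrite sumr_const card_ord.
apply: ler_sum => k _.
have := circle_exp_norm z k; have := circle_exp_norm w k.
set a := Re _; set b := Im _; set c := Re _; set e := Im _ => h1 h2.
have := sqr_ge0 (c - a); have := sqr_ge0 (e - b).
have := sqr_ge0 (c + a); have := sqr_ge0 (e + b).
rewrite ler_norml => *; apply/andP; split; lra.
Qed.

Let mean_cvg w z : mean w N.+1 z @[N --> \oo] --> (\1_[set w] z : R).
Proof.
have [->|zw] := pselect (z = w).
  by rewrite indicE mem_set//; under eq_fun do rewrite mean_diag; exact: cvg_cst.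
rewrite indicE memNset//.
pose x := circle_val z * ((circle_val w)^*)%C.
have x1 : x - 1 != 0.
  rewrite subr_eq0; apply/eqP => x1; apply: zw; apply: val_inj.
  have ww : circle_val w * ((circle_val w)^*)%C = 1.
    by rewrite -sqr_normc (eqP (valP w)) expr1n.
  have w0 : ((circle_val w)^*)%C != 0.
    by apply/eqP => w0; move: ww; rewrite w0 mulr0 => /esym/eqP; rewrite oner_eq0.
  by apply: (mulIf w0); rewrite -/(circle_val z) -/(circle_val w) ww.
have nx : `|x| = 1.
  by rewrite /x normrM normcJ (eqP (valP z)) (eqP (valP w)) mulr1.
pose D := Num.sqrt (Re (x - 1) ^+ 2 + Im (x - 1) ^+ 2).
have DE : `|x - 1| = (D%:C)%C by exact: normc_def.
have D0 : 0 < D by move: x1; rewrite -normr_gt0 DE ltcR.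
have bound N : `|Re (\sum_(k < N) x ^+ k)| <= 2 / D.
  rewrite ler_pdivlMr// mulrC -lecR.
  apply: (@le_trans _ _ `|x ^+ N - 1|).
    rewrite subrX1 normrM rmorphM /= DE ler_wpM2l//; first by rewrite ler0c ltW.
    exact: normc_ge_Re.
  rewrite (le_trans (ler_normB _ _))// normrX nx expr1n normr1.
  by rewrite -[X in _ <= X]/((1 + 1)%:C)%C rmorphD.
apply/cvgr0Pnorm_le => e e0; near=> N.
rewrite meanE normrM ger0_norm ?invr_ge0//.
rewrite ler_pdivrMl// (le_trans (bound _))//.
rewrite -ler_pdivrMr//.
apply: (@le_trans _ _ N%:R); last by rewrite ler_nat.
near: N; exact: nbhs_infty_ger.
Unshelve. all: by end_near. Qed.

Lemma wiener_atomless (sigma : {finite_measure set (circle R) -> \bar R})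
    (r : nat -> R) :
  (forall n, \int[sigma]_z Re (circle_val z ^+ n) = r n) ->
  (forall n, \int[sigma]_z Im (circle_val z ^+ n) = 0) ->
  (fun N : nat => N%:R^-1 * \sum_(k < N) `|r k|) @ \oo --> (0 : R) ->
  continuous_measure sigma.
Proof.
move=> hre him hr w.
have sfin : (sigma setT < +oo)%E by exact: fin_num_fun_lty.
have bterm k : bounded_measurable (fun z : circle R =>
    Re (circle_val z ^+ k) * Re (circle_val w ^+ k) +
    Im (circle_val z ^+ k) * Im (circle_val w ^+ k)).
  have [bre bim] := bm_circle_exp R k.
  by apply: bmD; apply: bmM => //; exact: bm_cst.
have bmean N : bounded_measurable (mean w N).
  by apply: bmM; [exact: bm_cst|exact: bm_sum].
have int_mean N : \int[sigma]_z mean w N z =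
    N%:R^-1 * \sum_(k < N) Re (circle_val w ^+ k) * r k.
  rewrite bm_RintegralZ//; last exact: bm_sum.
  rewrite bm_Rintegral_sum//; congr (_ * _); apply: eq_bigr => k _.
  have [bre bim] := bm_circle_exp R k.
  under eq_Rintegral do rewrite ![_ * Re (circle_val w ^+ k)]mulrC
    ![_ * Im (circle_val w ^+ k)]mulrC.
  rewrite bm_RintegralD//; [|by apply: bmM => //; exact: bm_cst..].
  by rewrite !bm_RintegralZ// hre him mulr0 addr0.
have c1 : \int[sigma]_z mean w N.+1 z @[N --> \oo] --> fine (sigma [set w]).
  rewrite -bm_Rintegral_indic; last exact: measurable_circle_set1.
  apply: (bm_cvg_Rintegral sfin (M := 1)).
  - by move=> N; have [] := bmean N.+1.
  - apply: measurable_indic; exact: measurable_circle_set1.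
  - by move=> N z; exact: mean_bound.
  - by apply: aeW => z; exact: mean_cvg.
have c2 : \int[sigma]_z mean w N.+1 z @[N --> \oo] --> (0 : R).
  apply/norm_cvg0P; move: hr; rewrite -(cvg_shiftS _) /= => hr.
  apply: squeeze_cvgr (cvg_cst 0) hr; apply: nearW => N /=.
  rewrite normr_ge0/= int_mean normrM ger0_norm ?invr_ge0//.
  rewrite ler_wpM2l ?invr_ge0// (le_trans (ler_norm_sum _ _ _))//.
  apply: ler_sum => k _; rewrite normrM ler_piMl//.
  have := circle_exp_norm w k; set a := Re _; set b := Im _ => ab.
  by rewrite -[leRHS]sqrtr1 -ab -sqrtr_sqr ler_wsqrtr// lerDl sqr_ge0.
have : fine (sigma [set w]) = 0 by exact: (cvg_unique _ c1 c2).
have : sigma [set w] \is a fin_num.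
  by apply: fin_num_measure; exact: measurable_circle_set1.
by move=> /fineK {2}<- ->.
Qed.

End wiener.

(** * Centred indicators *)

Lemma bm_Lfun2 (R : realType) d (X : measurableType d)
    (m : {measure set X -> \bar R}) (f : X -> R) :
  (m setT < +oo)%E -> bounded_measurable f -> f \in Lfun m 2%:E.
Proof.
move=> mfin bf; rewrite inE; apply/andP; split; rewrite inE/=; first by case: bf.
rewrite /finite_norm (@lty_poweRy _ _ 2)// powR_Lnorm//.
have := bm_integrable mfin (bmX 2 bf) => /integrableP[_].
apply: le_lt_trans; rewrite le_eqVlt; apply/predU1P; left.
apply: eq_integral => x _ /=.
by rewrite powR_mulrn// normrX.
Qed.

Section centered_indicator.
Context (R : realType) d (X : measurableType d) (mu : probability X R).
Context (T : automorphism mu).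

Definition centered (A : set X) (x : X) : R := \1_A x - fine (mu A).

Let mu_fin : (mu setT < +oo)%E.
Proof. by rewrite probability_setT ltry. Qed.

Lemma Rintegral_probability_cst (c : R) : \int[mu]_x c = c.
Proof.
rewrite Rintegral_cst// -[RHS]mulr1; congr (_ * _).
by have /(congr1 fine) := probability_setT mu.
Qed.

Lemma bm_centered A : measurable A -> bounded_measurable (centered A).
Proof. by move=> mA; apply: bmB; [exact: bm_indic|exact: bm_cst]. Qed.

Lemma Rintegral_centered A : measurable A -> \int[mu]_x centered A x = 0.
Proof.
move=> mA; rewrite bm_RintegralB//; [|exact: bm_indic|exact: bm_cst].
by rewrite bm_Rintegral_indic// Rintegral_probability_cst subrr.
Qed.

Lemma measurable_iter_aut n : measurable_fun setT (iter n T).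
Proof.
elim: n => [|n IH]; first exact: measurable_id.
exact: (measurableT_comp (measurable_aut_fun T) IH).
Qed.

Lemma autocorrelation_centered A n : measurable A ->
  autocorrelation T (centered A) n =
  fine (mu ((iter n T @^-1` A) `&` A)) - fine (mu A) * fine (mu A).
Proof.
move=> mA; rewrite /autocorrelation /ip.
have mTA : measurable (iter n T @^-1` A).
  by rewrite -[X in measurable X]setTI; exact: (measurable_iter_aut n).
have bA := bm_centered mA; have bTA := bm_iter T n bA.
have bI : bounded_measurable (fun x => \1_A (iter n T x) * \1_A x : R).
  apply: bmM; last exact: bm_indic.
  exact: (bm_iter T n (bm_indic R mA)).
transitivity (\int[mu]_x (\1_A (iter n T x) * \1_A x - fine (mu A) * fine (mu A)
    - fine (mu A) * centered A (iter n T x) - fine (mu A) * centered A x)).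
  by apply: eq_Rintegral => x _; rewrite /centered; ring.
have bc : bounded_measurable (fun _ : X => fine (mu A) * fine (mu A)) by exact: bm_cst.
have b1 : bounded_measurable (fun x => fine (mu A) * centered A x).
  by apply: bmM => //; exact: bm_cst.
have b2 : bounded_measurable (fun x => fine (mu A) * centered A (iter n T x)).
  by apply: bmM => //; exact: bm_cst.
rewrite bm_RintegralB//; last by apply: bmB => //; exact: bmB.
rewrite bm_RintegralB//; last exact: bmB.
rewrite bm_RintegralB// (bm_RintegralZ mu_fin _ bTA) (bm_RintegralZ mu_fin _ bA).
rewrite Rintegral_centered//.
have -> : \int[mu]_x centered A (iter n T x) = 0.
  rewrite -(Rintegral_centered mA).
  elim: n {mTA bTA bI b2} => // n IH.
  under eq_Rintegral do rewrite iterSr.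
  by rewrite (Rintegral_aut T (bm_iter T n bA)).
rewrite !mulr0 !subr0 Rintegral_probability_cst; congr (_ - _).
rewrite -bm_Rintegral_indic; last exact: measurableI.
by apply: eq_Rintegral => x _; rewrite indicI.
Qed.

(** The autocorrelations of a centred indicator are the very quantities that
    weak mixing sends to 0 in mean. *)
Lemma weakly_mixing_atomless A (sigma : {finite_measure set (circle R) -> \bar R}) :
  weakly_mixing T -> measurable A ->
  (forall n, \int[sigma]_z complex.Re (circle_val z ^+ n) =
    autocorrelation T (centered A) n) ->
  (forall n, \int[sigma]_z complex.Im (circle_val z ^+ n) = 0) ->
  continuous_measure sigma.
Proof.
move=> wm mA hre him; apply: (wiener_atomless hre him).
under eq_fun do under eq_bigr do rewrite autocorrelation_centered//.
exact: wm.
Qed.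

End centered_indicator.

Lemma autocorrelation_factor (R : realType) d d' (X : measurableType d)
    (Y : measurableType d') (mu : probability X R) (nu : probability Y R)
    (T : automorphism mu) (S : automorphism nu) (pi : X -> Y) (f : Y -> R) n :
  measurable_fun setT pi ->
  (forall A, measurable A -> nu A = mu (pi @^-1` A)) ->
  (forall x, pi (T x) = S (pi x)) -> bounded_measurable f ->
  autocorrelation T (f \o pi) n = autocorrelation S f n.
Proof.
move=> mpi nuE piT bf; rewrite /autocorrelation /ip; symmetry.
rewrite (@bm_Rintegral_image _ _ _ _ _ mu nu pi)//.
- apply: eq_Rintegral => x _ /=; congr (f _ * _).
  by elim: n => //= n ->.
- have mufin : (mu setT < +oo)%E by rewrite probability_setT ltry.
  exact: mufin.
- by apply: bmM => //; exact: bm_iter.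
Qed.

Lemma autocorrelation_prod (R : realType) d1 d2 (Y1 : measurableType d1)
    (Y2 : measurableType d2) (nu1 : probability Y1 R) (nu2 : probability Y2 R)
    (S1 : automorphism nu1) (S2 : automorphism nu2) (f : Y1 -> R) (g : Y2 -> R) n :
  bounded_measurable f -> bounded_measurable g ->
  autocorrelation (prod_aut S1 S2) (fun p => f p.1 * g p.2) n =
  autocorrelation S1 f n * autocorrelation S2 g n.
Proof.
move=> bf bg; rewrite /autocorrelation /ip -bm_Rintegral_prod.
- apply: eq_Rintegral => -[x y] _ /=.
  have -> : iter n (prod_map S1 S2) (x, y) = (iter n S1 x, iter n S2 y).
    by elim: n => //= n ->.
  by rewrite mulrACA.
- by apply: bmM => //; exact: bm_iter.
- by apply: bmM => //; exact: bm_iter.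
Qed.

Section spectral_measure_of_real_function.
Context (R : realType) d (X : measurableType d) (mu : probability X R).
Context (T : automorphism mu).
Local Open Scope complex_scope.

Let mu_fin : (mu setT < +oo)%E.
Proof. by rewrite probability_setT ltry. Qed.

Lemma real_cL20 (f : X -> R) : bounded_measurable f -> \int[mu]_x f x = 0 ->
  cL20 mu (fun x => (f x)%:C).
Proof.
move=> bf f0; split.
  by split; apply: bm_Lfun2 => //; exact: bm_cst.
move=> c; rewrite /cinner /cintegral.
have -> : (fun x => complex.Re ((f x)%:C * c^*)) = (fun x => complex.Re c * f x).
  by apply/funext => x; case: c => a b /=; rewrite mul0r subr0 mulrC.
have -> : (fun x => complex.Im ((f x)%:C * c^*)) = (fun x => - complex.Im c * f x).
  by apply/funext => x; case: c => a b /=; rewrite mul0r addr0 mulrC.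
by rewrite !bm_RintegralZ// f0 !mulr0.
Qed.

Lemma real_spectral_measure (f : X -> R)
    (sigma : {finite_measure set (circle R) -> \bar R}) :
  bounded_measurable f ->
  (forall n, \int[sigma]_z complex.Re (circle_val z ^+ n) = autocorrelation T f n) ->
  (forall n, \int[sigma]_z complex.Im (circle_val z ^+ n) = 0) ->
  spectral_measure T (fun x => (f x)%:C) sigma.
Proof.
move=> bf hre him n.
have -> : cinner mu (koopman T n (fun x => (f x)%:C)) (fun x => (f x)%:C) =
    (autocorrelation T f `|n|%N)%:C.
  rewrite /cinner /cintegral.
  have -> : (fun x => complex.Im (koopman T n (fun x => (f x)%:C) x * ((f x)%:C)^*)) =
      fun=> 0.
    by apply/funext => x /=; rewrite oppr0 mulr0 mul0r addr0.
  rewrite Rintegral_cst// mul0r; congr (_%:C).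
  have -> : (fun x => complex.Re (koopman T n (fun x => (f x)%:C) x * ((f x)%:C)^*)) =
      fun x => f (aut_iter T n x) * f x.
    by apply/funext => x /=; rewrite oppr0 mulr0 subr0.
  case: n => n //=; rewrite -/(ip mu (fun x => f (iter n.+1 (aut_inv T) x)) f).
  by rewrite ip_iter_inv// ipC.
case: n => n.
  by rewrite /cintegral hre him.
have -> : (fun z => circle_val z ^ Negz n) =
    (fun z : circle R => ((circle_val z ^+ n.+1)^*)).
  by apply/funext => z; rewrite -circle_exprN.
rewrite /cintegral -hre; congr (_ +i* _).
  by apply: eq_Rintegral => z _; case: (_ ^+ _).
rewrite -[RHS](mulr0 (-1)) -(him n.+1) -bm_RintegralZ.
- by apply: eq_Rintegral => z _; case: (_ ^+ _) => a b /=; rewrite mulN1r.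
- exact: fin_num_fun_lty.
- by have [] := bm_circle_exp R n.+1.
Qed.

End spectral_measure_of_real_function.

(** * Orthogonality from convolution singularity *)

Lemma rectangle_measure_unique (R : realType) d d' (X : measurableType d)
    (Y : measurableType d') (m1 m2 : {measure set (X * Y) -> \bar R}) :
  (m1 setT < +oo)%E ->
  (forall A B, measurable A -> measurable B -> m1 (A `*` B) = m2 (A `*` B)) ->
  forall E, measurable E -> m1 E = m2 E.
Proof.
move=> fin m12.
pose C : set (set (X * Y)) :=
  [set C | exists A, measurable A /\ exists B, measurable B /\ C = A `*` B].
have CI : setI_closed C.
  move=> /= _ _ [X1 [mX1 [X2 [mX2 ->]]]] [Y1 [mY1 [Y2 [mY2 ->]]]].
  rewrite -setXI; exists (X1 `&` Y1); split; first exact: measurableI.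
  by exists (X2 `&` Y2); split => //; exact: measurableI.
move=> E mE; apply: (measure_unique C (fun=> setT)) => //.
- rewrite measurable_prod_measurableType; congr (<<s _ >>).
  rewrite predeqE; split => [[A mA [B mB <-]]|[A [mA [B [mB ->]]]]].
    by exists A; split => //; exists B.
  by exists A => //; exists B.
- by move=> n; exists setT; split => //; exists setT; split => //; rewrite setXTT.
- by rewrite bigcup_const.
- by move=> _ [A [mA [B [mB ->]]]]; exact: m12.
Qed.

(** Apply uniqueness on rectangles twice, the first time to the measures
    D |-> m_i (A x D) for a fixed A. *)
Lemma box_measure_unique (R : realType) d d1 d2 (Z : measurableType d)
    (Y1 : measurableType d1) (Y2 : measurableType d2)
    (m1 m2 : {measure set (Z * (Y1 * Y2)) -> \bar R}) :
  (m1 setT < +oo)%E ->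
  (forall A B C, measurable A -> measurable B -> measurable C ->
    m1 (A `*` (B `*` C)) = m2 (A `*` (B `*` C))) ->
  forall E, measurable E -> m1 E = m2 E.
Proof.
move=> fin m12; apply: rectangle_measure_unique => // A D mA mD.
have mA' : measurable (A `*` [set: Y1 * Y2]) by exact: measurableX.
have msnd : measurable_fun setT (@snd Z (Y1 * Y2)) by exact: measurable_snd.
have [p1 p1E] := image_measure (mrestr m1 mA') msnd.
have [p2 p2E] := image_measure (mrestr m2 mA') msnd.
have sE D' : snd @^-1` D' `&` A `*` setT = A `*` D' :> set (Z * (Y1 * Y2)).
  by apply/seteqP; split => -[z y] /= => [[? []]|[]].
have pE1 D' : p1 D' = m1 (A `*` D') by rewrite p1E; congr (m1 _); exact: sE.
have pE2 D' : p2 D' = m2 (A `*` D') by rewrite p2E; congr (m2 _); exact: sE.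
rewrite -pE1 -pE2; apply: rectangle_measure_unique => // [|B C mB mC].
  rewrite pE1; apply: le_lt_trans fin; apply: le_measure; rewrite ?inE//.
by rewrite pE1 pE2 m12.
Qed.

Section circle_convolution.
Context (R : realType).
Local Notation Re := complex.Re.
Local Notation Im := complex.Im.
Variables l1 l2 : {finite_measure set (circle R) -> \bar R}.

Lemma prod_conj_invariant :
  (forall A, measurable A -> l1 (@circle_conj R @^-1` A) = l1 A) ->
  (forall A, measurable A -> l2 (@circle_conj R @^-1` A) = l2 A) ->
  forall A, measurable A ->
  (l1 \x l2)%E (prod_map (@circle_conj R) (@circle_conj R) @^-1` A) = (l1 \x l2)%E A.
Proof.
move=> h1 h2 A mA; have mc := @measurable_circle_conj R.
have [m' m'E] := image_measure (l1 \x l2)%E (measurable_prod_map mc mc).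
rewrite -m'E; symmetry; apply: product_measure_unique => // B C mB mC.
rewrite m'E; transitivity
    (l1 (@circle_conj R @^-1` B) * l2 (@circle_conj R @^-1` C))%E; last first.
  by congr (_ * _)%E; [exact: h1|exact: h2].
apply: product_measure1E; rewrite -[X in measurable X]setTI; exact: mc.
Qed.

(** Re (z w)^n = Re z^n Re w^n - Im z^n Im w^n, and the second term integrates
    to a product of zeros. *)
Lemma convolution_moment (r1 r2 : nat -> R) :
  (forall n, \int[l1]_z Re (circle_val z ^+ n) = r1 n) ->
  (forall n, \int[l1]_z Im (circle_val z ^+ n) = 0) ->
  (forall n, \int[l2]_z Re (circle_val z ^+ n) = r2 n) ->
  (forall n, \int[l2]_z Im (circle_val z ^+ n) = 0) ->
  forall n, \int[(l1 \x l2)%E]_p (cheb R n).[circle_height (circle_mul p)] = r1 n * r2 n.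
Proof.
move=> re1 im1 re2 im2 n; have [bre bim] := bm_circle_exp R n.
have fin1 : (l1 setT < +oo)%E by exact: fin_num_fun_lty.
have fin2 : (l2 setT < +oo)%E by exact: fin_num_fun_lty.
have fin12 : ((l1 \x l2)%E setT < +oo)%E.
  by rewrite -setXTT product_measure1E// lte_mul_pinfty// ge0_fin_numE.
under eq_Rintegral do rewrite cheb_circle_height /circle_mul /= exprMn Re_mul.
rewrite bm_RintegralB//.
- rewrite (bm_Rintegral_prod _ _ bre bre) (bm_Rintegral_prod _ _ bim bim).
  by rewrite re1 re2 im1 mul0r subr0.
- by apply: bmM; [exact: (bm_comp (@measurable_fst _ _ _ _) bre)|
    exact: (bm_comp (@measurable_snd _ _ _ _) bre)].
- by apply: bmM; [exact: (bm_comp (@measurable_fst _ _ _ _) bim)|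
    exact: (bm_comp (@measurable_snd _ _ _ _) bim)].
Qed.

End circle_convolution.

Definition joining_aut (R : realType) d1 d2 (X : measurableType d1)
    (Y : measurableType d2) (mu : probability X R) (nu : probability Y R)
    (T : automorphism mu) (S : automorphism nu)
    (lambda : probability (X * Y)%type R) (hl : joining T S lambda) :
    automorphism lambda :=
  let: And3 lambda_inv _ _ := hl in
  @Automorphism R _ _ lambda (prod_map T S) (prod_map (aut_inv T) (aut_inv S))
    (fun p => let: (x, y) := p in
       congr2 pair (aut_funK T x) (aut_funK S y))
    (fun p => let: (x, y) := p in
       congr2 pair (aut_invK T x) (aut_invK S y))
    (measurable_prod_map (measurable_aut_fun T) (measurable_aut_fun S))
    (measurable_prod_map (measurable_aut_inv T) (measurable_aut_inv S))
    lambda_inv.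

Lemma joining_autE (R : realType) d1 d2 (X : measurableType d1)
    (Y : measurableType d2) (mu : probability X R) (nu : probability Y R)
    (T : automorphism mu) (S : automorphism nu)
    (lambda : probability (X * Y)%type R) (hl : joining T S lambda) :
  joining_aut hl = prod_map T S :> (X * Y -> X * Y).
Proof. by case: hl. Qed.

Section convolution_singularity.
Context (R : realType) d d1 d2 (Z : measurableType d) (Y1 : measurableType d1)
  (Y2 : measurableType d2) (rho : probability Z R) (nu1 : probability Y1 R)
  (nu2 : probability Y2 R) (T : automorphism rho) (S1 : automorphism nu1)
  (S2 : automorphism nu2) (lambda : probability (Z * (Y1 * Y2))%type R).
Hypotheses (hCS : CS T) (wm1 : weakly_mixing S1) (wm2 : weakly_mixing S2)
  (hl : joining T (prod_aut S1 S2) lambda).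

(** The spectral measure of the first factor is dominated by the maximal spectral
    type, that of the product of the two others is a convolution of atomless
    measures. *)
Lemma CS_orthogonal A B C : measurable A -> measurable B -> measurable C ->
  \int[lambda]_w (centered rho A w.1 * (centered nu1 B w.2.1 * centered nu2 C w.2.2))
  = 0.
Proof.
move=> mA mB mC.
have bA := bm_centered rho mA; have bB := bm_centered nu1 mB.
have bC := bm_centered nu2 mC.
have [sA [reA imA _]] := herglotz T bA.
have [sB [reB imB conjB]] := herglotz S1 bB.
have [sC [reC imC conjC]] := herglotz S2 bC.
have cB := weakly_mixing_atomless wm1 mB reB imB.
have cC := weakly_mixing_atomless wm2 mC reC imC.
case: hCS => sigma [sigma_max _] sigma_sing.
have [E [mE sigmaE convE]] := sigma_sing sB sC cB cC.
have sAE : sA E = 0%E.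
  have := sigma_max _ _ (real_cL20 bA (Rintegral_centered rho mA))
    (real_spectral_measure bA reA imA).
  by move=> /null_content_dominatesP; apply.
pose bBC (p : Y1 * Y2) := centered nu1 B p.1 * centered nu2 C p.2.
have mBC : bounded_measurable bBC.
  by apply: bmM; [exact: (bm_comp (@measurable_fst _ _ _ _) bB)|
    exact: (bm_comp (@measurable_snd _ _ _ _) bC)].
have finA : (sA setT < +oo)%E by exact: fin_num_fun_lty.
have finB : (sB setT < +oo)%E by exact: fin_num_fun_lty.
have finC : (sC setT < +oo)%E by exact: fin_num_fun_lty.
have finBC : ((sB \x sC)%E setT < +oo)%E.
  by rewrite -setXTT product_measure1E// lte_mul_pinfty// ge0_fin_numE.
have mheight := @measurable_circle_height R.
have mmul := @measurable_circle_mul R.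
have marc := @measurable_arc R.
have mconj := @measurable_circle_conj R.
(* The convolution is invariant under conjugation, so E may be replaced by the
   largest symmetric set it contains, which is a set of heights. *)
pose G : set R := (@arc R @^-1` E) `&` ((@circle_conj R \o @arc R) @^-1` E).
have mG : measurable G.
  apply: measurableI; rewrite -[X in measurable X]setTI; first exact: marc.
  exact: (measurableT_comp mconj marc).
apply: (@singular_orthogonal _ _ _ _ (joining_aut hl) (fun w => centered rho A w.1)
  (bBC \o snd) _ _ _ _ sA (sB \x sC)%E (@circle_height R)
  (fun p => circle_height (circle_mul p)) G).
- exact: (bm_comp (@measurable_fst _ _ _ _) bA).
- exact: (bm_comp (@measurable_snd _ _ _ _) mBC).
- exact: finA.
- exact: finBC.
- exact: mheight.
- exact: (measurableT_comp mheight mmul).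
- exact: circle_height_itv.
- by move=> p; exact: circle_height_itv.
- move=> n; under eq_Rintegral do rewrite cheb_circle_height.
  rewrite reA; symmetry; apply: autocorrelation_factor => //.
  + by move=> A' mA'; case: hl => _ -> .
  + by move=> w; rewrite joining_autE.
- move=> n; rewrite (convolution_moment reB imB reC imC).
  rewrite -autocorrelation_prod//; symmetry; apply: autocorrelation_factor => //.
  + by move=> A' mA'; case: hl => _ _ -> .
  + by move=> w; rewrite joining_autE.
- exact: mG.
- apply: (subset_measure0 _ mE _ sAE) => [|z /=].
    by rewrite -[X in measurable X]setTI; exact: mheight.
  move=> [/= h1 h2]; have [e|e] := arc_circle_height z; first by rewrite -e.
  by move: h2; rewrite /= e circle_conjK.
- have mEc : measurable ((@circle_mul R) @^-1` ~` E).
    by rewrite -[X in measurable X]setTI; apply: mmul => //; exact: measurableC.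
  have mEc' : measurable (prod_map (@circle_conj R) (@circle_conj R) @^-1`
      ((@circle_mul R) @^-1` ~` E)).
    by rewrite -[X in measurable X]setTI; apply: (measurable_prod_map mconj mconj).
  have null : (sB \x sC)%E ((@circle_mul R @^-1` ~` E) `|`
      (prod_map (@circle_conj R) (@circle_conj R) @^-1` (@circle_mul R @^-1` ~` E))) = 0%E.
    have null' := etrans (prod_conj_invariant conjB conjC mEc) convE.
    exact: (null_set_setU mEc mEc' convE null').
  apply: (subset_measure0 _ _ _ null); last first.
  + move=> p /= nG; apply: contrapT => /not_orP[nE nE']; apply: nG.
    have conjM : circle_mul (prod_map (@circle_conj R) (@circle_conj R) p) =
        circle_conj (circle_mul p).
      by apply: val_inj; rewrite /= rmorphM.
    move: nE nE'; rewrite /= conjM => /contrapT nE /contrapT nE'.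
    have [e|e] := arc_circle_height (circle_mul p); split; rewrite /= e//.
    by rewrite circle_conjK.
  + exact: measurableU.
  + rewrite -[X in measurable X]setTI; apply: (measurableT_comp mheight mmul) => //.
    exact: measurableC.
Qed.

End convolution_singularity.

(** * Ergodicity of products of weakly mixing systems *)

Lemma probability_fin_num (R : realType) d (X : measurableType d)
  (mu : probability X R) A : measurable A -> mu A \is a fin_num.
Proof. by move=> mA; exact: fin_num_measure. Qed.

Lemma probability_splitE (R : realType) d (X : measurableType d)
  (mu : probability X R) A B : measurable A -> measurable B ->
  fine (mu A) = fine (mu (A `&` B)) + fine (mu (A `&` ~` B)).
Proof.
move=> mA mB; have mC := measurableC mB.
rewrite -fineD ?probability_fin_num//; [|exact: measurableI..].
congr fine; rewrite -measureU//; [|exact: measurableI|exact: measurableI|].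
  by rewrite -setIUr setUCr setIT.
by rewrite setIACA setICr setI0.
Qed.

Lemma weakly_mixing_ergodic (R : realType) d (X : measurableType d)
  (mu : probability X R) (T : automorphism mu) : weakly_mixing T -> ergodic mu T.
Proof.
move=> wm A mA TA; have fA := probability_fin_num mu mA.
have TAk k : iter k T @^-1` A = A.
  elim: k => // k IH; rewrite -[in RHS]IH -[in RHS]TA.
  by apply/seteqP; split => x; rewrite /= -iterS iterSr.
have := wm A A mA mA.
under eq_fun do under eq_bigr do rewrite TAk setIid.
set c := `|_|; rewrite -cvg_shiftS /= => h.
have c0 : c = 0.
  have : (fun N : nat => N.+1%:R^-1 * \sum_(k < N.+1) c) @ \oo --> c.
    under eq_fun do rewrite sumr_const card_ord -[c *+ _]mulr_natl mulKf//.
    exact: cvg_cst.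
  by move=> h'; exact: (cvg_unique _ h' h).
have /eqP := c0; rewrite normr_eq0 -{1}[fine _]mulr1 -mulrBr mulf_eq0 subr_eq0.
move=> /orP[/eqP A0|/eqP A1]; [left|right]; rewrite -(fineK fA).
  by rewrite A0.
by rewrite -A1.
Qed.

Section ergodic_product.
Context (R : realType) d1 d2 (X : measurableType d1) (Y : measurableType d2).
Context (mu : probability X R) (nu : probability Y R).
Context (T : automorphism mu) (S : automorphism nu).
Hypotheses (wmT : weakly_mixing T) (wmS : weakly_mixing S).
Local Notation kappa := (mu \x nu)%E.
Local Notation TS := (prod_map T S).

Let mTS : measurable_fun setT TS.
Proof. exact: measurable_prod_map (measurable_aut_fun T) (measurable_aut_fun S). Qed.

Let mTSk k : measurable_fun setT (iter k TS).
Proof.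
elim: k => [|k IH]; first exact: measurable_id.
exact: (measurableT_comp mTS IH).
Qed.

Let m_pre k E : measurable E -> measurable (iter k TS @^-1` E).
Proof. by move=> mE; rewrite -[X in measurable X]setTI; exact: mTSk. Qed.

Let kappa_iter k E : measurable E -> kappa (iter k TS @^-1` E) = kappa E.
Proof.
move=> mE; elim: k => // k IH; rewrite -[RHS]IH.
rewrite -(prod_map_preserving T S (m_pre k mE)); congr (kappa _).
by apply/seteqP; split => x; rewrite /= -iterS iterSr.
Qed.

Let iterE k p : iter k TS p = (iter k T p.1, iter k S p.2).
Proof. by elim: k => [|k /= ->]; case: p. Qed.

Let mean (F E : set (X * Y)) (N : nat) :=
  N%:R^-1 * \sum_(k < N) fine (kappa ((iter k TS @^-1` E) `&` F)).

(** Mixing in mean of E relative to F: for a fixed F, the sets E with this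
    property form a Dynkin class. *)
Let mixes (F E : set (X * Y)) :=
  mean F E @ \oo --> fine (kappa E) * fine (kappa F).

Let m_preI k E F : measurable E -> measurable F ->
  measurable ((iter k TS @^-1` E) `&` F).
Proof. by move=> mE mF; apply: measurableI => //; exact: m_pre. Qed.

Let kfin E : measurable E -> kappa E \is a fin_num.
Proof. exact: (probability_fin_num kappa). Qed.

Lemma mixes_rectangle A B C D : measurable A -> measurable B ->
  measurable C -> measurable D -> mixes (C `*` D) (A `*` B).
Proof.
move=> mA mB mC mD.
rewrite /mixes -cvg_shiftS /=.
pose a k := fine (mu ((iter k T @^-1` A) `&` C)).
pose b k := fine (nu ((iter k S @^-1` B) `&` D)).
pose a' := fine (mu A) * fine (mu C); pose b' := fine (nu B) * fine (nu D).
have pr01 d (W : measurableType d) (P : probability W R) U :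
    measurable U -> 0 <= fine (P U) <= 1.
  move=> mU; rewrite fine_ge0//= -lee_fin fineK ?probability_fin_num//.
  exact: probability_le1.
have mTA k : measurable ((iter k T @^-1` A) `&` C).
  apply: measurableI => //; rewrite -[X in measurable X]setTI.
  exact: (measurable_iter_aut T k).
have mSB k : measurable ((iter k S @^-1` B) `&` D).
  apply: measurableI => //; rewrite -[X in measurable X]setTI.
  exact: (measurable_iter_aut S k).
have meanE N : mean (C `*` D) (A `*` B) N = N%:R^-1 * \sum_(k < N) a k * b k.
  congr (_ * _); apply: eq_bigr => k _.
  have -> : (iter k TS @^-1` (A `*` B)) `&` C `*` D =
      ((iter k T @^-1` A) `&` C) `*` ((iter k S @^-1` B) `&` D).
    by apply/seteqP; split => -[x y]; rewrite /= iterE => -[[? ?] [? ?]].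
  by rewrite product_measure1E// fineM// ?probability_fin_num.
have -> : fine (kappa (A `*` B)) * fine (kappa (C `*` D)) = a' * b'.
  by rewrite !product_measure1E// !fineM// ?probability_fin_num// mulrACA.
have h1 : N.+1%:R^-1 * (\sum_(k < N.+1) `|a k - a'|) @[N --> \oo] --> (0 : R).
  by have := wmT mA mC; rewrite -cvg_shiftS.
have h2 : N.+1%:R^-1 * (\sum_(k < N.+1) `|b k - b'|) @[N --> \oo] --> (0 : R).
  by have := wmS mB mD; rewrite -cvg_shiftS.
have h : N.+1%:R^-1 * (\sum_(k < N.+1) `|a k - a'|) +
    N.+1%:R^-1 * (\sum_(k < N.+1) `|b k - b'|) @[N --> \oo] --> (0 : R).
  by rewrite -[X in _ --> X]addr0; exact: cvgD.
apply/subr_cvg0/norm_cvg0P; apply: squeeze_cvgr (cvg_cst 0) h.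
apply: nearW => N; rewrite /= normr_ge0/= meanE.
have -> : a' * b' = N.+1%:R^-1 * \sum_(k < N.+1) a' * b'.
  by rewrite sumr_const card_ord -[(_ * _) *+ _]mulr_natl mulKf.
rewrite -mulrBr -sumrB normrM ger0_norm ?invr_ge0// -mulrDr ler_wpM2l ?invr_ge0//.
rewrite (le_trans (ler_norm_sum _ _ _))// -big_split ler_sum// => k _ /=.
have -> : a k * b k - a' * b' = (a k - a') * b k + a' * (b k - b') by ring.
rewrite (le_trans (ler_normD _ _))// !normrM lerD//.
  have /andP[bk0 bk1] := pr01 _ _ nu _ (mSB k).
  by rewrite ler_piMr// ger0_norm.
have /andP[? ?] := pr01 _ _ mu _ mA; have /andP[? ?] := pr01 _ _ mu _ mC.
by rewrite ler_piMl// !ger0_norm// mulr_ile1.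
Qed.

Lemma mixesC E F : measurable E -> measurable F -> mixes F E -> mixes F (~` E).
Proof.
move=> mE mF; rewrite /mixes -[X in X -> _]cvg_shiftS -[X in _ -> X]cvg_shiftS /= => h.
have -> : fine (kappa (~` E)) * fine (kappa F) =
    fine (kappa F) - fine (kappa E) * fine (kappa F).
  rewrite -{2}[fine (kappa F)]mul1r -mulrBl; congr (_ * _).
  have := probability_splitE kappa measurableT mE; rewrite !setTI.
  by rewrite -[X in X = _ -> _]/(fine (kappa setT)) probability_setT /= => ->; ring.
have -> : (fun N => mean F (~` E) N.+1) = (fun N => fine (kappa F) - mean F E N.+1).
  apply/funext => N; rewrite /mean.
  rewrite -[X in X - _](mulKf (_ : N.+1%:R != 0 :> R))// mulr_natl -mulrBr.
  congr (_ * _); rewrite -[X in _ *+ X]card_ord -sumr_const -sumrB.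
  apply: eq_bigr => k _; rewrite preimage_setC.
  rewrite [X in _ = X - _](probability_splitE kappa mF (m_pre k mE)).
  by rewrite addrC [F `&` _]setIC addKr setIC.
by apply: cvgB => //; exact: cvg_cst.
Qed.

Lemma mixesU E1 E2 F : measurable E1 -> measurable E2 -> measurable F ->
  E1 `&` E2 = set0 -> mixes F E1 -> mixes F E2 -> mixes F (E1 `|` E2).
Proof.
move=> m1 m2 mF E12 h1 h2; rewrite /mixes.
have addE A1 A2 : measurable A1 -> measurable A2 -> A1 `&` A2 = set0 ->
    fine (kappa (A1 `|` A2)) = fine (kappa A1) + fine (kappa A2).
  by move=> mA1 mA2 A12; rewrite measureU// fineD// kfin.
rewrite addE// mulrDl.
have -> : mean F (E1 `|` E2) = (fun N => mean F E1 N + mean F E2 N).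
  apply/funext => N; rewrite /mean -mulrDr -big_split; congr (_ * _).
  apply: eq_bigr => k _ /=; rewrite preimage_setU setIUl addE//; try exact: m_preI.
  by rewrite setIACA setIid -preimage_setI E12 preimage_set0 set0I.
exact: cvgD.
Qed.

(** By invariance, replacing the union by a finite part changes every mean by at
    most the measure of the rest, whatever N. *)
Lemma mixes_bigcup F (G : nat -> set (X * Y)) : measurable F ->
  (forall n, measurable (G n)) -> trivIset setT G ->
  (forall n, mixes F (G n)) -> mixes F (\bigcup_n G n).
Proof.
move=> mF mG tG hG.
have mU : measurable (\bigcup_n G n) by exact: bigcup_measurable.
pose H n := \big[setU/set0]_(k < n) G k.
have mH n : measurable (H n) by exact: bigsetU_measurable.
have HU n : H n `<=` \bigcup_n G n.
  by rewrite /H -bigcup_mkord => p [k _ Gk]; exists k.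
have hH n : mixes F (H n).
  elim: n => [|n IH].
    rewrite /H big_ord0 /mixes measure0 mul0r.
    have -> : mean F set0 = fun=> 0; last exact: cvg_cst.
    apply/funext => N; rewrite /mean big1 ?mulr0// => k _.
    by rewrite preimage_set0 set0I measure0.
  rewrite /H big_ord_recr /=; apply: (mixesU (mH n) (mG n) mF _ IH (hG n)).
  rewrite /H -subset0 -bigcup_mkord => z [[k /= kn Gk] Gn].
  have kn' : k != n by rewrite neq_ltn kn.
  move/trivIsetP : tG => /(_ k n Logic.I Logic.I kn').
  by rewrite -subset0 => /(_ z); apply.
pose t n := fine (kappa (\bigcup_n G n)) - fine (kappa (H n)).
have t0 : t n @[n --> \oo] --> (0 : R).
  have : kappa (H n) @[n --> \oo] --> kappa (\bigcup_n G n).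
    have -> : \bigcup_n G n = \bigcup_n H n.
      apply/seteqP; split => [p [n _ Gn]|p [n _ Hn]]; last exact: HU Hn.
      by exists n.+1 => //; rewrite /H big_ord_recr; right.
    apply: nondecreasing_cvg_mu => //; first exact: bigcup_measurable.
    by move=> m n mn; apply/subsetPset; exact: subset_bigsetU.
  rewrite -[X in _ --> X]fineK ?kfin// => /fine_cvg h.
  rewrite -(subrr (fine (kappa (\bigcup_n G n)))); apply: cvgB => //.
  exact: cvg_cst.
have diff A B : measurable A -> measurable B -> A `<=` B ->
    fine (kappa B) - fine (kappa A) = fine (kappa (B `&` ~` A)).
  move=> mA mB AB; rewrite (probability_splitE kappa mB mA).
  by rewrite (setIidr AB) addrC addKr.
have mean_diff n N : `|mean F (\bigcup_n G n) N.+1 - mean F (H n) N.+1| <= t n.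
  rewrite /mean -mulrBr -sumrB normrM ger0_norm ?invr_ge0// ler_pdivrMl//.
  rewrite (le_trans (ler_norm_sum _ _ _))//.
  rewrite mulr_natl -[X in _ *+ X]card_ord -sumr_const ler_sum// => k _.
  rewrite diff; [|exact: m_preI|exact: m_preI|].
  - rewrite ger0_norm ?fine_ge0// /t diff//.
    have mD : measurable (\bigcup_n G n `&` ~` H n).
      by apply: measurableI => //; exact: measurableC.
    rewrite -(kappa_iter k mD); apply: fine_le; rewrite ?kfin//.
    + by apply: measurableI; [exact: m_preI|apply: measurableC; exact: m_preI].
    + exact: m_pre.
    + apply: le_measure; rewrite ?inE.
      * by apply: measurableI; [exact: m_preI|apply: measurableC; exact: m_preI].
      * exact: m_pre.
      * by move=> p [[pU pF] /not_andP[pH|]//].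
  - by apply: setSI => p; exact: HU.
have kF1 : fine (kappa F) <= 1.
  by rewrite -lee_fin fineK ?kfin//; exact: (@probability_le1 _ _ _ kappa).
rewrite /mixes -cvg_shiftS /=; apply/cvgrPdist_lt => e e0.
have e3 : 0 < e / 4 by rewrite divr_gt0.
have [n tn] : exists n, `|t n| < e / 4.
  near \oo => n; exists n; near: n.
  by have /cvgrPdist_lt/(_ _ e3) := t0; apply: filterS => n; rewrite sub0r normrN.
have tF : `|fine (kappa (\bigcup_n G n)) * fine (kappa F) -
    fine (kappa (H n)) * fine (kappa F)| < e / 4.
  apply: le_lt_trans tn; rewrite -mulrBl normrM ler_piMr// ger0_norm//.
  exact: fine_ge0.
near=> N.
have hN : `|fine (kappa (H n)) * fine (kappa F) - mean F (H n) N.+1| < e / 4.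
  near: N; have := hH n; rewrite /mixes -cvg_shiftS /= => /cvgrPdist_lt; exact.
have := mean_diff n N; have := le_lt_trans (ler_norm _) tn.
move: tF hN; rewrite !ltr_norml !ler_norml => /andP[? ?] /andP[? ?] ? /andP[? ?].
apply/andP; split; lra.
Unshelve. all: by end_near. Qed.

(** An invariant set mixes with every rectangle, hence is independent of it; so
    it is independent of all sets, and of itself. *)
Lemma ergodic_prod : ergodic kappa TS.
Proof.
move=> E mE TSE.
have TSk k : iter k TS @^-1` E = E.
  elim: k => // k IH; rewrite -[in RHS]IH -[in RHS]TSE.
  by apply/seteqP; split => x; rewrite /= -iterS iterSr.
have indep A B : measurable A -> measurable B ->
    fine (kappa (E `&` (A `*` B))) = fine (kappa E) * fine (kappa (A `*` B)).
  move=> mA mB; have mAB : measurable (A `*` B) by exact: measurableX.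
  have hE : mixes (A `*` B) E.
    pose RG : set (set (X * Y)) :=
      [set C | exists C1, measurable C1 /\ exists C2, measurable C2 /\ C = C1 `*` C2].
    have RGE : @measurable _ (X * Y)%type = <<s RG >>.
      rewrite measurable_prod_measurableType; congr (<<s _ >>).
      rewrite predeqE; split => [[C1 mC1 [C2 mC2 <-]]|[C1 [mC1 [C2 [mC2 ->]]]]].
        by exists C1; split => //; exists C2.
      by exists C1 => //; exists C2.
    have := mE; rewrite RGE; apply: dynkin_induction => //.
    - move=> _ _ [X1 [mX1 [X2 [mX2 ->]]]] [Y1 [mY1 [Y2 [mY2 ->]]]].
      rewrite -setXI; exists (X1 `&` Y1); split; first exact: measurableI.
      by exists (X2 `&` Y2); split => //; exact: measurableI.
    - by rewrite -setXTT; exact: mixes_rectangle.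
    - by move=> _ [C1 [mC1 [C2 [mC2 ->]]]]; exact: mixes_rectangle.
    - by move=> C mC; exact: mixesC.
    - by move=> G mG tG; exact: mixes_bigcup.
  have hc : mean (A `*` B) E N.+1 @[N --> \oo] --> fine (kappa (E `&` (A `*` B))).
    have -> : (fun N => mean (A `*` B) E N.+1) =
        fun=> fine (kappa (E `&` (A `*` B))).
      apply/funext => N; rewrite /mean.
      under eq_bigr do rewrite TSk.
      by rewrite sumr_const card_ord -[fine _ *+ _]mulr_natl mulKf.
    exact: cvg_cst.
  have hE' : mean (A `*` B) E N.+1 @[N --> \oo] -->
      fine (kappa E) * fine (kappa (A `*` B)).
    by move: hE; rewrite /mixes -cvg_shiftS.
  exact: (cvg_unique _ hc hE').
have kE0 : 0 <= fine (kappa E) by exact: fine_ge0.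
pose m1 : {measure set (X * Y) -> \bar R} := mrestr kappa mE.
pose m2 : {measure set (X * Y) -> \bar R} := mscale (NngNum kE0) kappa.
have : m1 E = m2 E.
  apply: rectangle_measure_unique => //.
    rewrite /m1 /= /mrestr setTI -ge0_fin_numE//; exact: kfin.
  move=> A B mA mB; have mAB : measurable (A `*` B) by exact: measurableX.
  rewrite /m1 /m2 /= /mrestr /mscale /= setIC.
  rewrite -[LHS]fineK; last exact: (kfin (measurableI _ _ mE mAB)).
  rewrite indep// EFinM; congr (_ * _)%E; exact: (fineK (kfin mAB)).
rewrite /m1 /m2 /= /mrestr /mscale /= setIid -[kappa E]fineK; last exact: kfin.
rewrite -EFinM => -[].
set c := fine _ => /eqP; rewrite -{1}[c]mulr1 -subr_eq0 -mulrBr mulf_eq0 subr_eq0.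
by move=> /orP[/eqP ->|/eqP <-]; [left|right].
Qed.

End ergodic_product.

(** * Two ergodic measures are equal or mutually singular *)

Lemma hahn_set (R : realType) d (X : measurableType d) (lam kap : probability X R) :
  exists P, [/\ measurable P,
    forall A, measurable A -> A `<=` P -> (kap A <= lam A)%E &
    forall A, measurable A -> A `<=` ~` P -> (lam A <= kap A)%E].
Proof.
pose nu : {charge set X -> \bar R} :=
  cadd (charge_of_finite_measure lam) (cscale (-1) (charge_of_finite_measure kap)).
have nuE A : nu A = (lam A - kap A)%E.
  by rewrite /nu /= /cadd /= cscaleN1.
have [P [N [[mP posP] [mN negN] PN PN0]]] := Hahn_decomposition nu.
exists P; split => // A mA AP.
  by have := posP A mA AP; rewrite nuE sube_ge0// probability_fin_num.
have AN : A `<=` N.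
  by move=> x Ax; have : [set: X] x by []; rewrite -PN => -[/(AP _ Ax)|].
by have := negN A mA AN; rewrite nuE sube_le0.
Qed.

Section ergodic_dichotomy.
Context (R : realType) d (X : measurableType d) (kap lam : probability X R).
Context (T : automorphism kap).
Hypothesis lam_inv : forall A, measurable A -> lam (T @^-1` A) = lam A.

Let agree A := forall B, measurable B -> B `<=` A -> lam B = kap B.

Let agree_bigcup (F : nat -> set X) : (forall n, measurable (F n)) ->
  (forall n, agree (F n)) -> agree (\bigcup_n F n).
Proof.
move=> mF aF B mB BF.
have mS n : measurable (seqDU F n).
  by apply: measurableD => //; exact: bigsetU_measurable.
have BE : B = \bigcup_n (B `&` seqDU F n).
  by rewrite -setI_bigcupr -seqDU_bigcup_eq; apply/esym/setIidl.
have mBS n : measurable (B `&` seqDU F n) by exact: measurableI.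
have tBS : trivIset setT (fun n => B `&` seqDU F n).
  exact/trivIset_setIl/trivIset_seqDU.
rewrite BE !measure_semi_bigcup//; try by rewrite -BE.
apply: eq_eseriesr => n _; apply: (aF n) => // x [_]; exact: subset_seqDU.
Qed.

Let m_iter n A : measurable A -> measurable (iter n T @^-1` A).
Proof.
by move=> mA; rewrite -[X in measurable X]setTI; exact: (measurable_iter_aut T n).
Qed.

Let m_inv A : measurable A -> measurable (aut_inv T @^-1` A).
Proof.
by move=> mA; rewrite -[X in measurable X]setTI; exact: (measurable_aut_inv T).
Qed.

Let transport A : measurable A ->
  kap (aut_inv T @^-1` A) = kap A /\ lam (aut_inv T @^-1` A) = lam A.
Proof.
move=> mA; have mI := m_inv mA.
have -> : kap A = kap (T @^-1` (aut_inv T @^-1` A)).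
  by congr (kap _); apply/seteqP; split => x; rewrite /= aut_funK.
have -> : lam A = lam (T @^-1` (aut_inv T @^-1` A)).
  by congr (lam _); apply/seteqP; split => x; rewrite /= aut_funK.
by rewrite (aut_preserving T mI) lam_inv.
Qed.

Let transport_le (Q : set X) n :
  (forall A, measurable A -> A `<=` Q -> (kap A <= lam A)%E) ->
  forall A, measurable A -> A `<=` iter n T @^-1` Q -> (kap A <= lam A)%E.
Proof.
move=> hQ; elim: n => [|n IH] A mA AQ; first exact: hQ.
have [<- <-] := transport mA; apply: IH; first exact: m_inv.
by move=> x /= Ax; have := AQ _ Ax; rewrite /= -iterS iterSr aut_invK.
Qed.

Let transport_ge (Q : set X) n :
  (forall A, measurable A -> A `<=` Q -> (lam A <= kap A)%E) ->
  forall A, measurable A -> A `<=` iter n T @^-1` Q -> (lam A <= kap A)%E.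
Proof.
move=> hQ; elim: n => [|n IH] A mA AQ; first exact: hQ.
have [<- <-] := transport mA; apply: IH; first exact: m_inv.
by move=> x /= Ax; have := AQ _ Ax; rewrite /= -iterS iterSr aut_invK.
Qed.

(** A positive set of the Hahn decomposition of lam - kap is almost invariant,
    because its translates are positive sets too; made invariant, it gets
    measure 0 or 1, and more from lam than from kap. *)
Let dichotomy_lt E : ergodic kap T -> ergodic lam T -> measurable E ->
  fine (kap E) < fine (lam E) ->
  exists N, [/\ measurable N, kap N = 0%E & lam (~` N) = 0%E].
Proof.
move=> ek el mE ltE.
have [P [mP posP negP]] := hahn_set lam kap.
have mPC := measurableC mP.
(* The lower limit of the translates of P is invariant, and differs from P by
   a set on which the two measures coincide. *)
pose N := \bigcup_m \bigcap_(n in [set n | (m <= n)%N]) (iter n T @^-1` P).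
have mN : measurable N.
  apply: bigcup_measurable => m _; apply: bigcap_measurable; first by exists m => /=.
  by move=> n _; exact: m_iter.
have NT : T @^-1` N = N.
  apply/seteqP; split => x /= [m _ hm].
    exists m.+1 => // -[|n] //= mn; rewrite -iterS iterSr; exact: hm.
  by exists m => // n /= mn; rewrite -iterSr; apply: hm; exact: leqW.
have a1 : agree (\bigcup_n (P `&` (iter n T @^-1` (~` P)))).
  apply: agree_bigcup => n.
    by apply: measurableI => //; exact: m_iter.
  move=> B mB BP; apply/eqP; rewrite eq_le; apply/andP; split.
    by apply: (transport_ge (n := n) negP) => // x /BP[].
  by apply: posP => // x /BP[].
have a2 : agree (\bigcup_n ((iter n T @^-1` P) `&` ~` P)).
  apply: agree_bigcup => n.
    by apply: measurableI => //; exact: m_iter.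
  move=> B mB BP; apply/eqP; rewrite eq_le; apply/andP; split.
    by apply: negP => // x /BP[].
  by apply: (transport_le (n := n) posP) => // x /BP[].
have PN : lam (P `&` ~` N) = kap (P `&` ~` N).
  apply: a1; first by apply: measurableI => //; exact: measurableC.
  move=> x [Px nN]; apply: contrapT => h; apply: nN; exists 0%N => // n _ /=.
  by apply: contrapT => nP; apply: h; exists n.
have NP : lam (N `&` ~` P) = kap (N `&` ~` P).
  apply: a2; first exact: measurableI.
  by move=> x [[m _ hm] nP]; exists m => //; split => //; exact: hm (leqnn m).
have fle A : measurable A -> (kap A <= lam A)%E -> fine (kap A) <= fine (lam A).
  by move=> mA; apply: fine_le; exact: probability_fin_num.
have fge A : measurable A -> (lam A <= kap A)%E -> fine (lam A) <= fine (kap A).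
  by move=> mA; apply: fine_le; exact: probability_fin_num.
have ltN : fine (kap N) < fine (lam N).
  have sp (mu : probability X R) := probability_splitE mu.
  have mEP := measurableI _ _ mP mE; have mPE := measurableI _ _ mP (measurableC mE).
  have mEPC := measurableI _ _ mE mPC.
  have := sp lam E P mE mP; have := sp kap E P mE mP.
  have := sp lam P E mP mE; have := sp kap P E mP mE.
  have := sp lam P N mP mN; have := sp kap P N mP mN.
  have := sp lam N P mN mP; have := sp kap N P mN mP.
  rewrite PN NP [N `&` P]setIC [E `&` P]setIC.
  have := fle _ mPE (posP _ mPE (@subIsetl _ _ _)).
  have := fge _ mEPC (negP _ mEPC (@subIsetr _ _ _)).
  lra.
have [kN|kN] := ek N mN NT; have [lN|lN] := el N mN NT;
  rewrite kN lN /= ?ltxx// in ltN.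
- by exists N; split => //; rewrite probability_setC// lN subee.
- by move: ltN; rewrite ltr10.
Qed.

Lemma ergodic_dichotomy : ergodic kap T -> ergodic lam T ->
  (forall A, measurable A -> lam A = kap A) \/
  exists N, [/\ measurable N, kap N = 0%E & lam (~` N) = 0%E].
Proof.
move=> ek el.
have [|/existsNP[E /not_implyP[mE neq]]] :=
  pselect (forall A, measurable A -> lam A = kap A); first by left.
right; have [lt|gt|eq] := ltgtP (fine (kap E)) (fine (lam E)).
- exact: dichotomy_lt lt.
- apply: (@dichotomy_lt (~` E)) => //; first exact: measurableC.
  have fC (mu : probability X R) : fine (mu (~` E)) = 1 - fine (mu E).
    by rewrite probability_setC// fineB// probability_fin_num.
  by rewrite !fC; lra.
- by exfalso; apply: neq; rewrite -[LHS]fineK ?probability_fin_num// -eq fineK// probability_fin_num.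
Qed.

End ergodic_dichotomy.

(** * Joining primeness *)

Section joining_primeness_proof.
Context (R : realType) d d1 d2 (Z : measurableType d) (Y1 : measurableType d1)
  (Y2 : measurableType d2) (rho : probability Z R) (nu1 : probability Y1 R)
  (nu2 : probability Y2 R) (T : automorphism rho) (S1 : automorphism nu1)
  (S2 : automorphism nu2) (lambda : probability (Z * (Y1 * Y2))%type R).
Hypotheses (hCS : CS T) (wmT : weakly_mixing T) (wm1 : weakly_mixing S1)
  (wm2 : weakly_mixing S2) (hl : joining T (prod_aut S1 S2) lambda).

Local Notation W := (Z * (Y1 * Y2))%type.
Local Notation lambda1 := (distribution lambda (@proj_Z1 _ _ _ Z Y1 Y2)).
Local Notation lambda2 := (distribution lambda (@proj_Z2 _ _ _ Z Y1 Y2)).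

Let lambda_fin : (lambda setT < +oo)%E.
Proof. by rewrite probability_setT ltry. Qed.

Let boxI (A : set Z) (B : set Y1) (C : set Y2) :
  (fun w : W => \1_A w.1 * (\1_B w.2.1 * \1_C w.2.2) : R) =
  \1_(A `*` (B `*` C)).
Proof.
by apply/funext => -[z [y1 y2]]; rewrite !indicE !in_setX /= -!natrM !mulnb.
Qed.

Let centered_expansion (x a b c y z : R) :
  x - c * y - (b * z - b * c * a) = 0 -> x + a * (b * c) = y * c + z * b.
Proof. by move=> h; apply/eqP; rewrite -subr_eq0 -h; apply/eqP; ring. Qed.

(** The orthogonality relation, expanded by means of the independence of Y1 and
    Y2 under lambda. *)
Lemma CS_box A B C : measurable A -> measurable B -> measurable C ->
  fine (lambda (A `*` (B `*` C))) + fine (rho A) * (fine (nu1 B) * fine (nu2 C)) =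
  fine (lambda1 (A `*` B)) * fine (nu2 C) + fine (lambda2 (A `*` C)) * fine (nu1 B).
Proof.
move=> mA mB mC; have [_ hZ hY] := hl.
have bB := bm_centered nu1 mB; have bC := bm_centered nu2 mC.
have bA := bm_indic R mA.
pose F (p : Y1 * Y2) := centered nu1 B p.1 * centered nu2 C p.2.
have bF : bounded_measurable F.
  by apply: bmM; [exact: (bm_comp (@measurable_fst _ _ _ _) bB)|
    exact: (bm_comp (@measurable_snd _ _ _ _) bC)].
have bFw : bounded_measurable (fun w : W => F w.2).
  exact: (bm_comp (@measurable_snd _ _ _ _) bF).
have bAw : bounded_measurable (fun w : W => \1_A w.1 : R).
  exact: (bm_comp (@measurable_fst _ _ _ _) bA).
have F0 : \int[lambda]_w F w.2 = 0.
  rewrite -(@bm_Rintegral_image _ _ _ _ _ lambda (nu1 \x nu2)%E snd F)//.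
    by rewrite bm_Rintegral_prod// Rintegral_centered// mul0r.
  by move=> D mD; exact/esym/hY.
have AF0 : \int[lambda]_w (\1_A w.1 * F w.2) = 0.
  have := CS_orthogonal hCS wm1 wm2 hl mA mB mC; rewrite -/(F _).
  have -> : (fun w : W => centered rho A w.1 * F w.2) =
      (fun w => \1_A w.1 * F w.2 - fine (rho A) * F w.2).
    by apply/funext => w; rewrite /centered mulrBl.
  rewrite bm_RintegralB//; [|exact: bmM|by apply: bmM => //; exact: bm_cst].
  by rewrite bm_RintegralZ// F0 mulr0 subr0.
have boxE A' B' C' : measurable A' -> measurable B' -> measurable C' ->
    bounded_measurable (\1_(A' `*` (B' `*` C')) : W -> R) /\
    \int[lambda]_w \1_(A' `*` (B' `*` C')) w = fine (lambda (A' `*` (B' `*` C'))).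
  move=> mA' mB' mC'; have m : measurable (A' `*` (B' `*` C')).
    by apply: measurableX => //; exact: measurableX.
  by split; [exact: bm_indic|exact: bm_Rintegral_indic].
have [b1 i1] := boxE _ _ _ mA mB mC.
have [b2 i2] := boxE _ _ _ mA mB measurableT.
have [b3 i3] := boxE _ _ _ mA measurableT mC.
have [b4 i4] := boxE _ _ _ mA measurableT measurableT.
have l1E : lambda1 (A `*` B) = lambda (A `*` (B `*` setT)).
  by congr (lambda _); apply/seteqP; split => -[z [y1 y2]] /= => [[? ?]|[? []]].
have l2E : lambda2 (A `*` C) = lambda (A `*` (setT `*` C)).
  by congr (lambda _); apply/seteqP; split => -[z [y1 y2]] /= => [[? ?]|[? []]].
have l3E : lambda (A `*` (setT `*` setT)) = rho A.
  rewrite -hZ//; congr (lambda _).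
  by apply/seteqP; split => -[z [y1 y2]] /= => [[? ?]|?].
have := AF0.
have -> : (fun w : W => \1_A w.1 * F w.2) = (fun w =>
    \1_(A `*` (B `*` C)) w - fine (nu2 C) * \1_(A `*` (B `*` setT)) w
    - (fine (nu1 B) * \1_(A `*` (setT `*` C)) w
       - fine (nu1 B) * fine (nu2 C) * \1_(A `*` (setT `*` setT)) w)).
  apply/funext => w; rewrite -!boxI !indicT /F /centered /=; ring.
have bZ c (h : W -> R) : bounded_measurable h -> bounded_measurable (fun w => c * h w).
  by move=> bh; apply: bmM => //; exact: bm_cst.
rewrite bm_RintegralB//; [|by apply: bmB => //; exact: bZ|by apply: bmB; exact: bZ].
rewrite bm_RintegralB//; last exact: bZ.
rewrite bm_RintegralB//; [|exact: bZ|exact: bZ].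
rewrite (bm_RintegralZ lambda_fin _ b2) (bm_RintegralZ lambda_fin _ b3)
  (bm_RintegralZ lambda_fin _ b4) i1 i2 i3 i4 -l1E -l2E l3E.
exact: centered_expansion.
Qed.

Let assoc1 (w : (Z * Y1) * Y2) : W := (w.1.1, (w.1.2, w.2)).
Let assoc2 (w : (Z * Y2) * Y1) : W := (w.1.1, (w.2, w.1.2)).

Let m_assoc1 : measurable_fun setT assoc1.
Proof.
apply/measurable_fun_pairP; split.
  exact: (measurableT_comp measurable_fst measurable_fst).
apply/measurable_fun_pairP; split; last exact: measurable_snd.
exact: (measurableT_comp measurable_snd measurable_fst).
Qed.

Let m_assoc2 : measurable_fun setT assoc2.
Proof.
apply/measurable_fun_pairP; split.
  exact: (measurableT_comp measurable_fst measurable_fst).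
apply/measurable_fun_pairP; split; first exact: measurable_snd.
exact: (measurableT_comp measurable_snd measurable_fst).
Qed.

Let box_measure1 (m : probability (Z * Y1)%type R) A B C :
  measurable A -> measurable B -> measurable C ->
  (m \x nu2)%E (assoc1 @^-1` (A `*` (B `*` C))) = (m (A `*` B) * nu2 C)%E.
Proof.
move=> mA mB mC; rewrite -product_measure1E//; last exact: measurableX.
by congr (_ _); apply/seteqP; split => -[[z y1] y2] /= => [[? []]|[[]]].
Qed.

Let box_measure2 (m : probability (Z * Y2)%type R) A B C :
  measurable A -> measurable B -> measurable C ->
  (m \x nu1)%E (assoc2 @^-1` (A `*` (B `*` C))) = (m (A `*` C) * nu1 B)%E.
Proof.
move=> mA mB mC; rewrite -product_measure1E//; last exact: measurableX.
by congr (_ _); apply/seteqP; split => -[[z y1] y2] /= => [[? []]|[[]]].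
Qed.

Let nu12 : probability (Y1 * Y2)%type R := (nu1 \x nu2)%E.
Let kappa : probability W R := (rho \x nu12)%E.

Let kappa_box A B C : measurable A -> measurable B -> measurable C ->
  kappa (A `*` (B `*` C)) = (rho A * (nu1 B * nu2 C))%E.
Proof.
move=> mA mB mC; have mBC : measurable (B `*` C) by exact: measurableX.
by rewrite [LHS]product_measure1E//; congr (_ * _)%E; exact: product_measure1E.
Qed.

Lemma CS_decomposition E : measurable E ->
  (lambda E + kappa E =
   (lambda1 \x nu2)%E (assoc1 @^-1` E) + (lambda2 \x nu1)%E (assoc2 @^-1` E))%E.
Proof.
have [M1 M1E] := image_measure (lambda1 \x nu2)%E m_assoc1.
have [M2 M2E] := image_measure (lambda2 \x nu1)%E m_assoc2.
have fin1 : (M1 setT < +oo)%E.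
  by rewrite M1E preimage_setT [X in (X < _)%E](_ : _ = 1%E) ?ltry//;
    exact: (@probability_setT _ _ _ (lambda1 \x nu2)%E).
have fin2 : (M2 setT < +oo)%E.
  by rewrite M2E preimage_setT [X in (X < _)%E](_ : _ = 1%E) ?ltry//;
    exact: (@probability_setT _ _ _ (lambda2 \x nu1)%E).
have fink : (kappa setT < +oo)%E.
  by rewrite probability_setT ltry.
have [s1 s1E _] := @finite_measure_add _ _ _ lambda kappa lambda_fin fink.
have [s2 s2E _] := finite_measure_add fin1 fin2.
move=> mE; rewrite -M1E -M2E -s1E -s2E; apply: box_measure_unique => //.
  exact: fin_num_fun_lty.
move=> A B C mA mB mC.
rewrite [LHS]s1E [RHS]s2E M1E M2E; transitivity
    (lambda1 (A `*` B) * nu2 C + lambda2 (A `*` C) * nu1 B)%E; last first.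
  by congr (_ + _)%E; [exact/esym/box_measure1|exact/esym/box_measure2].
have mBC : measurable (B `*` C) by exact: measurableX.
have mABC : measurable (A `*` (B `*` C)) by exact: measurableX.
have mAB : measurable (A `*` B) by exact: measurableX.
have mAC : measurable (A `*` C) by exact: measurableX.
have e : (lambda (A `*` (B `*` C)) + rho A * (nu1 B * nu2 C) =
    lambda1 (A `*` B) * nu2 C + lambda2 (A `*` C) * nu1 B)%E.
  rewrite -[lambda _](fineK (probability_fin_num lambda mABC)).
  rewrite -(fineK (probability_fin_num rho mA)) -(fineK (probability_fin_num nu1 mB)).
  rewrite -(fineK (probability_fin_num nu2 mC)).
  rewrite -(fineK (probability_fin_num lambda1 mAB)).
  rewrite -(fineK (probability_fin_num lambda2 mAC)).
  by rewrite -!EFinM -!EFinD; congr EFin; exact: CS_box.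
by apply: etrans e; congr (_ + _)%E; exact: kappa_box.
Qed.

Let kappa_assoc1 E : measurable E ->
  ((rho \x nu1) \x nu2)%E (assoc1 @^-1` E) = kappa E.
Proof.
have [M1 M1E] := image_measure ((rho \x nu1) \x nu2)%E m_assoc1.
move=> mE; rewrite -M1E; apply: box_measure_unique => //.
  by rewrite M1E preimage_setT [X in (X < _)%E](_ : _ = 1%E) ?ltry//;
    exact: (@probability_setT _ _ _ ((rho \x nu1) \x nu2)%E).
move=> A B C mA mB mC; rewrite M1E.
apply: etrans (box_measure1 (rho \x nu1)%E mA mB mC) _.
apply: etrans _ (esym (kappa_box mA mB mC)); rewrite muleA; congr (_ * _)%E.
exact: product_measure1E.
Qed.

Let kappa_assoc2 E : measurable E ->
  ((rho \x nu2) \x nu1)%E (assoc2 @^-1` E) = kappa E.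
Proof.
have [M2 M2E] := image_measure ((rho \x nu2) \x nu1)%E m_assoc2.
move=> mE; rewrite -M2E; apply: box_measure_unique => //.
  by rewrite M2E preimage_setT [X in (X < _)%E](_ : _ = 1%E) ?ltry//;
    exact: (@probability_setT _ _ _ ((rho \x nu2) \x nu1)%E).
move=> A B C mA mB mC; rewrite M2E.
apply: etrans (box_measure2 (rho \x nu2)%E mA mB mC) _.
apply: etrans _ (esym (kappa_box mA mB mC)).
rewrite (muleC (nu1 B)) muleA; congr (_ * _)%E.
exact: product_measure1E.
Qed.

Hypothesis lambda_ergodic : ergodic lambda (prod_map T (prod_aut S1 S2)).

Let image_ergodic d' (V : measurableType d') (m : probability V R) (S : V -> V)
    (pi : W -> V) : measurable_fun setT pi ->
  (forall E, m E = lambda (pi @^-1` E)) ->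
  (forall w, pi (prod_map T (prod_aut S1 S2) w) = S (pi w)) ->
  (forall E, measurable E -> measurable (S @^-1` E)) ->
  (forall E, measurable E -> m (S @^-1` E) = m E) /\ ergodic m S.
Proof.
move=> mpi mE piS mS; have [inv _ _] := hl.
have mpre E : measurable E -> measurable (pi @^-1` E).
  by move=> mE'; rewrite -[X in measurable X]setTI; exact: mpi.
have preS E : pi @^-1` (S @^-1` E) = prod_map T (prod_aut S1 S2) @^-1` (pi @^-1` E).
  by apply/seteqP; split => w; rewrite /= piS.
split=> E mE'; first by rewrite !mE preS; apply: inv; exact: mpre.
move=> SE; rewrite !mE; apply: lambda_ergodic; first exact: mpre.
by rewrite -preS SE.
Qed.

(** Each lambda_i is ergodic, as an image of lambda, so it equals rho (x) nu_i or
    is singular to it; CS_decomposition settles each case. *)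
Lemma CS_splits_off : splits_off2 nu2 lambda \/ splits_off1 nu1 lambda.
Proof.
have mS1 E : measurable E -> measurable (prod_map T S1 @^-1` E).
  move=> mE; rewrite -[X in measurable X]setTI.
  exact: (measurable_prod_map (measurable_aut_fun T) (measurable_aut_fun S1)).
have mS2 E : measurable E -> measurable (prod_map T S2 @^-1` E).
  move=> mE; rewrite -[X in measurable X]setTI.
  exact: (measurable_prod_map (measurable_aut_fun T) (measurable_aut_fun S2)).
have [inv1 erg1] := @image_ergodic _ _ lambda1 (prod_map T S1) _
  (@measurable_proj_Z1 _ _ _ Z Y1 Y2) (fun=> erefl) (fun=> erefl) mS1.
have [inv2 erg2] := @image_ergodic _ _ lambda2 (prod_map T S2) _
  (@measurable_proj_Z2 _ _ _ Z Y1 Y2) (fun=> erefl) (fun=> erefl) mS2.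
have kfin E : measurable E -> kappa E \is a fin_num.
  exact: (probability_fin_num kappa).
have dec := CS_decomposition.
have cancel_kappa E a b : measurable E -> (lambda E + kappa E = a + b)%E ->
    a = kappa E -> lambda E = b.
  move=> mE h ak; move: h; rewrite ak [RHS]addeC => /(congr1 (fun x => x - kappa E)%E).
  by rewrite !addeK ?kfin.
have prod_eq d0 (V : measurableType d0) d0' (V' : measurableType d0')
    (p p' : probability V R) (q : probability V' R) :
    (forall E, measurable E -> p E = p' E) ->
    forall E, measurable E -> (p \x q)%E E = (p' \x q)%E E.
  move=> pp' E mE; apply: product_measure_unique => // A B mA mB.
  apply: etrans (product_measure1E p' q mA mB) _; congr (_ * _)%E.
  exact/esym/pp'.
have mpre1 E : measurable E -> measurable (assoc1 @^-1` E).
  by move=> mE; rewrite -[X in measurable X]setTI; exact: m_assoc1.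
have mpre2 E : measurable E -> measurable (assoc2 @^-1` E).
  by move=> mE; rewrite -[X in measurable X]setTI; exact: m_assoc2.
have [l1E|[N1 [mN1 k1N1 l1N1]]] := @ergodic_dichotomy _ _ _ (rho \x nu1)%E lambda1
  (prod_aut T S1) inv1 (ergodic_prod wmT wm1) erg1.
  right=> E mE; apply: (cancel_kappa _ _ _ mE (dec E mE)).
  apply: etrans (kappa_assoc1 mE).
  exact: (prod_eq _ _ _ _ lambda1 (rho \x nu1)%E nu2 l1E _ (mpre1 _ mE)).
have [l2E|[N2 [mN2 k2N2 l2N2]]] := @ergodic_dichotomy _ _ _ (rho \x nu2)%E lambda2
  (prod_aut T S2) inv2 (ergodic_prod wmT wm2) erg2.
  left=> E mE; apply: (cancel_kappa _ _ _ mE (etrans (dec E mE) (addeC _ _))).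
  apply: etrans (kappa_assoc2 mE).
  exact: (prod_eq _ _ _ _ lambda2 (rho \x nu2)%E nu1 l2E _ (mpre2 _ mE)).
exfalso.
(* Off N1 and N2 both marginal terms vanish, while the independent joining has
   full mass there. *)
have mN1C := measurableC mN1; have mN2C := measurableC mN2.
have mp1 E : measurable E -> measurable (@proj_Z1 _ _ _ Z Y1 Y2 @^-1` E).
  by move=> mE; rewrite -[X in measurable X]setTI; exact: measurable_proj_Z1.
have mp2 E : measurable E -> measurable (@proj_Z2 _ _ _ Z Y1 Y2 @^-1` E).
  by move=> mE; rewrite -[X in measurable X]setTI; exact: measurable_proj_Z2.
pose E : set W := (@proj_Z1 _ _ _ Z Y1 Y2 @^-1` ~` N1) `&`
  (@proj_Z2 _ _ _ Z Y1 Y2 @^-1` ~` N2).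
have mE : measurable E by apply: measurableI; [exact: mp1|exact: mp2].
have null1 : (lambda1 \x nu2)%E (assoc1 @^-1` E) = 0%E.
  have h : (lambda1 \x nu2)%E (~` N1 `*` setT) = 0%E.
    by apply: etrans (product_measure1E _ _ mN1C measurableT) _; rewrite [X in (X * _)%E]l1N1 mul0e.
  apply: (subset_measure0 (mpre1 _ mE) _ _ h); first exact: measurableX.
  by move=> -[[z y1] y2] /= [].
have null2 : (lambda2 \x nu1)%E (assoc2 @^-1` E) = 0%E.
  have h : (lambda2 \x nu1)%E (~` N2 `*` setT) = 0%E.
    by apply: etrans (product_measure1E _ _ mN2C measurableT) _; rewrite [X in (X * _)%E]l2N2 mul0e.
  apply: (subset_measure0 (mpre2 _ mE) _ _ h); first exact: measurableX.
  by move=> -[[z y2] y1] /= [].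
have kE : kappa E = 0%E.
  have := dec E mE; rewrite null1 null2 adde0 => /eqP.
  by rewrite padde_eq0// => /andP[_ /eqP].
have kN1 : kappa (@proj_Z1 _ _ _ Z Y1 Y2 @^-1` N1) = 0%E.
  rewrite -kappa_assoc1; last exact: mp1.
  have -> : assoc1 @^-1` (@proj_Z1 _ _ _ Z Y1 Y2 @^-1` N1) = N1 `*` setT.
    by apply/seteqP; split => -[[z y1] y2] /= => [|[]].
  by apply: etrans (product_measure1E _ _ mN1 measurableT) _; rewrite [X in (X * _)%E]k1N1 mul0e.
have kN2 : kappa (@proj_Z2 _ _ _ Z Y1 Y2 @^-1` N2) = 0%E.
  rewrite -kappa_assoc2; last exact: mp2.
  have -> : assoc2 @^-1` (@proj_Z2 _ _ _ Z Y1 Y2 @^-1` N2) = N2 `*` setT.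
    by apply/seteqP; split => -[[z y2] y1] /= => [|[]].
  by apply: etrans (product_measure1E _ _ mN2 measurableT) _; rewrite [X in (X * _)%E]k2N2 mul0e.
have kEC : kappa (~` E) = 0%E.
  rewrite /E setCI -!preimage_setC !setCK.
  by apply: null_set_setU => //; [exact: mp1|exact: mp2].
by have := probability_setC kappa mE; rewrite kE kEC sube0 => /(congr1 fine) /= /eqP; rewrite eq_sym oner_eq0.
Qed.

End joining_primeness_proof.

Theorem proposition4 (R : realType) (d : measure_display) (Z : measurableType d)
    (rho : probability Z R) (T : automorphism rho)
    (hZ : standard_borel R Z) (hwm : weakly_mixing T) (hCS : CS T) :
  JP T.
Proof.
split; first exact: weakly_mixing_ergodic.
move=> d1 d2 Y1 Y2 nu1 nu2 S1 S2 lambda _ _ wm1 wm2 [hl erg].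
exact: (CS_splits_off hCS hwm wm1 wm2 hl erg).
Qed.
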